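(* Let $a<b$, $c<d$. For any $\mathbb R^{q\times n}$-valued $L_2$ functions $Z_1,\dots,Z_9$ ($Z_1$ of $(x,y)$; $Z_2,Z_3$ of $(x,y,\theta)$; $Z_4,Z_5$ of $(x,y,\nu)$; $Z_6,\dots,Z_9$ of $(x,y,\theta,\nu)$, with $x,\theta\in[a,b]$, $y,\nu\in[c,d]$) and any scalar function $g\in L_2[x,y]$ satisfying $g(x,y)\ge0$ for all $(x,y)\in[a,b]\times[c,d]$, let $\mathcal L_{\mathrm{PI}}:\mathbb R^{9q\times9q}\to\mathcal N_{2D}^{n\times n}$ be the map defined in the context. Then for any $P\ge0$ (positive semidefinite $P\in\mathbb R^{9q\times 9q}$), if $N=\mathcal L_{\mathrm{PI}}(P)$, we have $\mathcal P[N]^*=\mathcal P[N]$ and $$\langle u,\mathcal P[N]u\rangle_{L_2}\ge0\qquad\text{for any }u\in L_2^n([a,b]\times[c,d]).$$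
   Context: 2D-PI operators: $\mathcal N_{2D}^{n\times n}$ is the set of arrays $N=(N_{ij})_{i,j=0}^2$ of $\mathbb R^{n\times n}$-valued $L_2$ functions $N_{00}(x,y)$, $N_{0j}(x,y,\nu)$, $N_{i0}(x,y,\theta)$, $N_{ij}(x,y,\theta,\nu)$ ($i,j\in\{1,2\}$), $x,\theta\in[a,b]$, $y,\nu\in[c,d]$, and $(\mathcal P[N]u)(x,y)=N_{00}u(x,y)+\int_a^xN_{10}u(\theta,y)d\theta+\int_x^bN_{20}u(\theta,y)d\theta+\int_c^yN_{01}u(x,\nu)d\nu+\int_y^dN_{02}u(x,\nu)d\nu+\int_a^x\int_c^yN_{11}u(\theta,\nu)d\nu d\theta+\int_x^b\int_c^yN_{21}u(\theta,\nu)d\nu d\theta+\int_a^x\int_y^dN_{12}u(\theta,\nu)d\nu d\theta+\int_x^b\int_y^dN_{22}u(\theta,\nu)d\nu d\theta$. Re-indexing: write $Z_{00}=Z_1$, $Z_{10}=Z_2$, $Z_{20}=Z_3$, $Z_{01}=Z_4$, $Z_{02}=Z_5$, $Z_{11}=Z_6$, $Z_{21}=Z_7$, $Z_{12}=Z_8$, $Z_{22}=Z_9$; when $Z_{ij}(x,y,\theta,\nu)$ is written with four arguments it does not depend on $\theta$ if $i=0$ nor on $\nu$ if $j=0$. Partition $P\in\mathbb R^{9q\times9q}$ into $q\times q$ blocks $P_{k\ell}$, $k,\ell\in\{1,\dots,9\}$, and write $P_{(ij),(i'j')}$ for the block whose row and column correspond to $Z_{ij}$ and $Z_{i'j'}$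 in this numbering. Put $\bar0=0$, $\bar1=2$, $\bar2=1$. Definition: $N=\mathcal L_{\mathrm{PI}}(P)$ is given for $k,r\in\{0,1,2\}$ by $$N_{kr}(x,y,\theta,\nu)=\int_a^b\int_c^d\sum_{i,j,p,s=0}^2\Psi_{kij}(x,\eta,\theta)\Psi_{rps}(y,\mu,\nu)\,g(\eta,\mu)\,[Z_{\bar i\bar p}(\eta,\mu,x,y)]^T\,P_{(\bar i\bar p),(js)}\,Z_{js}(\eta,\mu,\theta,\nu)\,d\mu\,d\eta.$$ Here, on an interval $[\alpha,\beta]$ ($[a,b]$ or $[c,d]$ according to the variables), let $\delta(\xi,\sigma)=\delta(\sigma,\xi)$ be the Dirac delta, $\int_\alpha^\beta\delta(\xi,\sigma)f(\sigma)d\sigma=f(\xi)$; $I(\xi,\sigma)=1$ if $\sigma<\xi$ and $0$ otherwise; $H(\xi,\sigma,\tau)=1$ if $\tau<\sigma<\xi$ and $0$ otherwise; and $\Psi_{kij}(\xi,\sigma,\tau)$ is: $\delta(\xi,\sigma)$ for $kij=000,101,202$; $\delta(\tau,\sigma)$ for $110,220$; $H(\xi,\sigma,\tau)$ for $111$; $H(\tau,\sigma,\xi)$ for $222$; $I(\tau,\sigma)$ for $112$; $I(\xi,\sigma)$ for $212$; $I(\sigma,\xi)$ for $121$; $I(\sigma,\tau)$ for $221$; $0$ for all other $kij\in\{0,1,2\}^3$. For example, $N_{00}(x,y)=g(x,y)Z_1(x,y)^TP_{11}Z_1(x,y)$ and, for $\theta<x$, $N_{10}(x,y,\theta)=g(x,y)Z_1(x,y)^TP_{12}Z_2(x,y,\theta)+g(\theta,y)Z_3(\theta,y,x)^TP_{31}Z_1(\theta,y)+\int_x^bg(\eta,y)Z_2(\eta,y,x)^TP_{22}Z_2(\eta,y,\theta)d\eta+\int_\theta^xg(\eta,y)Z_3(\eta,y,x)^TP_{32}Z_2(\eta,y,\theta)d\eta+\int_a^\theta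 g(\eta,y)Z_3(\eta,y,x)^TP_{33}Z_3(\eta,y,\theta)d\eta$.
   Formalization: Added: for each i,j and all u in L2^n, the integral of g(|Z_ij||u|)^2 over the rectangle is finite, |Z_ij||u| being the (i,j) partial integral of |Z_ij||u|. Otherwise P[N] need not act on L2: g=1, Z_1=x^(-1/5) on [0,1]^2 gives multiplication by x^(-2/5). *)

(* Defs.v *)
From HB Require Import structures.
From mathcomp Require Import all_boot all_order all_algebra.
From mathcomp Require Import all_classical all_reals all_analysis.
Import Order.TTheory GRing.Theory Num.Theory.
Import numFieldNormedType.Exports.

Set Implicit Arguments.
Unset Strict Implicit.
Unset Printing Implicit Defensive.

Local Open Scope classical_set_scope.
Local Open Scope ring_scope.

(* The nine functions of a 2D-PI parameter array, [pi_ij] being the component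
   of index (i, j). In the numbering Z_1, ..., Z_9 the fields appear in order. *)
Record pi_array (R : realType) (m n : nat) := PiArray {
  pi_00 : R -> R -> 'M[R]_(m, n);            (* x, y *)
  pi_10 : R -> R -> R -> 'M[R]_(m, n);       (* x, y, theta *)
  pi_20 : R -> R -> R -> 'M[R]_(m, n);       (* x, y, theta *)
  pi_01 : R -> R -> R -> 'M[R]_(m, n);       (* x, y, nu *)
  pi_02 : R -> R -> R -> 'M[R]_(m, n);       (* x, y, nu *)
  pi_11 : R -> R -> R -> R -> 'M[R]_(m, n);  (* x, y, theta, nu *)
  pi_21 : R -> R -> R -> R -> 'M[R]_(m, n);
  pi_12 : R -> R -> R -> R -> 'M[R]_(m, n);
  pi_22 : R -> R -> R -> R -> 'M[R]_(m, n)
}.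

(* Component (i, j) as a function of all four arguments. In this file indices
   in {0,1,2} are natural numbers, and values above 2 are never used. *)
Definition pi_ker (R : realType) (m n : nat) (Z : pi_array R m n) (i j : nat)
    (x y t v : R) : 'M[R]_(m, n) :=
  match i, j with
  | 0, 0 => pi_00 Z x y
  | 1, 0 => pi_10 Z x y t
  | _, 0 => pi_20 Z x y t
  | 0, 1 => pi_01 Z x y v
  | 1, 1 => pi_11 Z x y t v
  | _, 1 => pi_21 Z x y t v
  | 0, _ => pi_02 Z x y v
  | 1, _ => pi_12 Z x y t v
  | _, _ => pi_22 Z x y t v
  end%N.

Section L2.
Variable R : realType.
Local Notation leb := (@lebesgue_measure R).

Definition leb2 := (leb \x leb)%E.
Definition leb3 := (leb2 \x leb)%E.
Definition leb4 := (leb3 \x leb)%E.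

(* f is square integrable on D; its values outside D are irrelevant. *)
Definition L2_on d (T : measurableType d) (mu : {measure set T -> \bar R})
    (D : set T) (f : T -> R) : Prop :=
  f \_ D \in Lfun mu 2%:E.

Definition L2_mx d (T : measurableType d) (mu : {measure set T -> \bar R})
    (D : set T) (m n : nat) (F : T -> 'M[R]_(m, n)) : Prop :=
  forall (i : 'I_m) (j : 'I_n), L2_on mu D (fun z => F z i j).

Variables a b c d : R.

Definition rect : set (measurableTypeR R * measurableTypeR R) :=
  `[a, b] `*` `[c, d].

Definition L2_rect (n : nat) (u : R -> R -> 'cV[R]_n) : Prop :=
  L2_mx leb2 rect (fun z => u z.1 z.2).

(* For m = n this is membership in N_2D^(n x n). *)
Definition N2D (m n : nat) (Z : pi_array R m n) : Prop :=
  [/\ L2_mx leb2 rect (fun z => pi_00 Z z.1 z.2),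
      L2_mx leb3 (rect `*` `[a, b]) (fun z => pi_10 Z z.1.1 z.1.2 z.2)
    & L2_mx leb3 (rect `*` `[a, b]) (fun z => pi_20 Z z.1.1 z.1.2 z.2)] /\
  [/\ L2_mx leb3 (rect `*` `[c, d]) (fun z => pi_01 Z z.1.1 z.1.2 z.2)
    & L2_mx leb3 (rect `*` `[c, d]) (fun z => pi_02 Z z.1.1 z.1.2 z.2)] /\
  [/\ L2_mx leb4 (rect `*` `[a, b] `*` `[c, d])
        (fun z => pi_11 Z z.1.1.1 z.1.1.2 z.1.2 z.2),
      L2_mx leb4 (rect `*` `[a, b] `*` `[c, d])
        (fun z => pi_21 Z z.1.1.1 z.1.1.2 z.1.2 z.2),
      L2_mx leb4 (rect `*` `[a, b] `*` `[c, d])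
        (fun z => pi_12 Z z.1.1.1 z.1.1.2 z.1.2 z.2)
    & L2_mx leb4 (rect `*` `[a, b] `*` `[c, d])
        (fun z => pi_22 Z z.1.1.1 z.1.1.2 z.1.2 z.2)].

Definition inner (n : nat) (u v : R -> R -> 'cV[R]_n) : R :=
  \int[leb2]_(z in rect) \sum_(k < n) u z.1 z.2 k 0 * v z.1 z.2 k 0.

(* S is the Hilbert space adjoint of T, both being everywhere defined on
   L_2^n(rect) with values in L_2^n(rect). *)
Definition is_adjoint (n : nat)
    (T S : (R -> R -> 'cV[R]_n) -> (R -> R -> 'cV[R]_n)) : Prop :=
  [/\ forall u, L2_rect u -> L2_rect (T u),
      forall u, L2_rect u -> L2_rect (S u)
    & forall u v, L2_rect u -> L2_rect v -> inner (T u) v = inner u (S v)].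

End L2.

Section PIOperator.
Variables (R : realType) (a b c d : R).
Local Notation leb := (@lebesgue_measure R).

(* P[N]u for a 2D-PI parameter array N. *)
Definition PI_op (n : nat) (N : pi_array R n n) (u : R -> R -> 'cV[R]_n)
    (x y : R) : 'cV[R]_n :=
  \col_(k < n)
  ((pi_00 N x y *m u x y) k 0
   + (\int[leb]_(t in `[a, x]) (pi_10 N x y t *m u t y) k 0)
   + (\int[leb]_(t in `[x, b]) (pi_20 N x y t *m u t y) k 0)
   + (\int[leb]_(v in `[c, y]) (pi_01 N x y v *m u x v) k 0)
   + (\int[leb]_(v in `[y, d]) (pi_02 N x y v *m u x v) k 0)
   + (\int[leb]_(t in `[a, x]) \int[leb]_(v in `[c, y])
        (pi_11 N x y t v *m u t v) k 0)
   + (\int[leb]_(t in `[x, b]) \int[leb]_(v in `[c, y])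
        (pi_21 N x y t v *m u t v) k 0)
   + (\int[leb]_(t in `[a, x]) \int[leb]_(v in `[y, d])
        (pi_12 N x y t v *m u t v) k 0)
   + (\int[leb]_(t in `[x, b]) \int[leb]_(v in `[y, d])
        (pi_22 N x y t v *m u t v) k 0)).

End PIOperator.

Section LPI.
Variables (R : realType) (a b c d : R).
Local Notation leb := (@lebesgue_measure R).

(* A generalized function of one real variable s: the Dirac delta at p, or an
   ordinary function h. *)
Inductive gfun := GDelta (p : R) | GFun (h : R -> R).

(* The integral of psi * f over [al, be], for p in [al, be] if psi = delta_p. *)
Definition gint (al be : R) (psi : gfun) (f : R -> R) : R :=
  match psi with
  | GDelta p => f p
  | GFun h => \int[leb]_(s in `[al, be]) (h s * f s)
  end.

Definition I_fun (xi s : R) : R := if s < xi then 1 else 0.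
Definition H_fun (xi s tau : R) : R := if tau < s < xi then 1 else 0.

(* Psi_kij(xi, s, tau) as a generalized function of s. *)
Definition Psi (k i j : nat) (xi tau : R) : gfun :=
  match k, i, j with
  | 0, 0, 0 | 1, 0, 1 | 2, 0, 2 => GDelta xi
  | 1, 1, 0 | 2, 2, 0 => GDelta tau
  | 1, 1, 1 => GFun (fun s => H_fun xi s tau)
  | 2, 2, 2 => GFun (fun s => H_fun tau s xi)
  | 1, 1, 2 => GFun (fun s => I_fun tau s)
  | 2, 1, 2 => GFun (fun s => I_fun xi s)
  | 1, 2, 1 => GFun (fun s => I_fun s xi)
  | 2, 2, 1 => GFun (fun s => I_fun s tau)
  | _, _, _ => GFun (fun _ => 0%R)
  end%N.

Definition bar (i : nat) : nat :=
  match i with 0 => 0 | 1 => 2 | _ => 1 end%N.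

(* Z_ij = Z_(pos i j + 1) *)
Definition pos (i j : nat) : 'I_9 :=
  match i, j with
  | 0, 0 => @Ordinal 9 0 isT
  | 1, 0 => @Ordinal 9 1 isT
  | _, 0 => @Ordinal 9 2 isT
  | 0, 1 => @Ordinal 9 3 isT
  | 1, 1 => @Ordinal 9 5 isT
  | _, 1 => @Ordinal 9 6 isT
  | 0, _ => @Ordinal 9 4 isT
  | 1, _ => @Ordinal 9 7 isT
  | _, _ => @Ordinal 9 8 isT
  end%N.

Lemma blk_idx_subproof (q : nat) (k : 'I_9) (al : 'I_q) : (k * q + al < 9 * q)%N.
Proof.
apply: (@leq_trans (k.+1 * q)); last by rewrite leq_mul2r ltn_ord orbT.
by rewrite mulSn addnC ltn_add2r.
Qed.

Definition blk_idx (q : nat) (k : 'I_9) (al : 'I_q) : 'I_(9 * q) :=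
  Ordinal (blk_idx_subproof k al).

(* The q x q block of P in block row k and block column l. *)
Definition blk (q : nat) (P : 'M[R]_(9 * q)) (k l : 'I_9) : 'M[R]_q :=
  \matrix_(al, be) P (blk_idx k al) (blk_idx l be).

Definition psd (m : nat) (P : 'M[R]_m) : Prop :=
  P^T = P /\ forall w : 'cV[R]_m, 0 <= (w^T *m P *m w) 0 0.

Definition LPI_ker (q n : nat) (Z : pi_array R q n) (g : R -> R -> R)
    (P : 'M[R]_(9 * q)) (k r : nat) (x y t v : R) : 'M[R]_n :=
  \matrix_(al, be)
    \sum_(i < 3) \sum_(j < 3) \sum_(p < 3) \sum_(s < 3)
      gint a b (Psi k i j x t) (fun eta =>
      gint c d (Psi r p s y v) (fun mu =>
        g eta mu *
        ((pi_ker Z (bar i) (bar p) eta mu x y)^T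
           *m blk P (pos (bar i) (bar p)) (pos j s)
           *m pi_ker Z j s eta mu t v) al be)).

(* LPI_ker k r does not depend on t if k = 0, nor on v if r = 0; the arguments
   x and y passed below in these places are arbitrary. *)
Definition LPI (q n : nat) (Z : pi_array R q n) (g : R -> R -> R)
    (P : 'M[R]_(9 * q)) : pi_array R n n :=
  {| pi_00 := fun x y => LPI_ker Z g P 0 0 x y x y;
     pi_10 := fun x y t => LPI_ker Z g P 1 0 x y t y;
     pi_20 := fun x y t => LPI_ker Z g P 2 0 x y t y;
     pi_01 := fun x y v => LPI_ker Z g P 0 1 x y x v;
     pi_02 := fun x y v => LPI_ker Z g P 0 2 x y x v;
     pi_11 := LPI_ker Z g P 1 1;
     pi_21 := LPI_ker Z g P 2 1;
     pi_12 := LPI_ker Z g P 1 2;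
     pi_22 := LPI_ker Z g P 2 2 |}.

(* f(xi), the integral of f over [al, xi], or the integral of f over [xi, be],
   for i = 0, 1, 2. *)
Definition epart (al be : R) (i : nat) (xi : R) (f : R -> \bar R) : \bar R :=
  match i with
  | 0 => f xi
  | 1 => \int[leb]_(s in `[al, xi]) f s
  | _ => \int[leb]_(s in `[xi, be]) f s
  end%N%E.

(* For every u in L_2^n, the functions obtained by integrating |Z_ij| |u| are
   square integrable with respect to g(x, y) dx dy. By Tonelli, this says that
   for every P all the integrals in <u, P[LPI(P)] u> converge absolutely as
   multiple integrals. It holds if g and the Z_ij are bounded. Square
   integrability of g and of the Z_ij does not imply it: with g = 1,
   Z_00 = x^(-1/5) on [0, 1]^2, and the other Z_ij equal to 0, the operator
   P[LPI(1)] is multiplication by x^(-2/5), which does not map L_2 to L_2. *)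
Definition LPI_well_posed (q n : nat) (Z : pi_array R q n) (g : R -> R -> R) :
    Prop :=
  forall (i j : 'I_3) (u : R -> R -> 'cV[R]_n), L2_rect a b c d u ->
    (\int[@leb2 R]_(z in rect a b c d)
       ((g z.1 z.2)%:E *
        (epart a b i z.1 (fun t => epart c d j z.2 (fun v =>
           (\sum_(al < q) \sum_(be < n)
              `|pi_ker Z i j z.1 z.2 t v al be| * `|u t v be 0|)%:E))) ^+ 2)
     < +oo)%E.

End LPI.

(* Main.v *)
Require Import Defs.
From HB Require Import structures.
From mathcomp Require Import all_boot all_order all_algebra.
From mathcomp Require Import all_classical all_reals all_analysis.
From mathcomp Require Import measurable_realfun ring lra.
Import Order.TTheory GRing.Theory Num.Theory.
Import numFieldNormedType.Exports.

(* Every one-variable integral of the statement, including evaluation at a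
   point, is integration against a Dirac delta or a density. For nonnegative
   integrands Tonelli's theorem reorders these layers: in each variable and for
   each pair (i, j),
     sum_k dx part_k(x)(dt) Psi_kij(x, t)(deta)
       = deta part_(bar i)(eta)(dx) part_j(eta)(dt),
   both sides restricting (eta, x, t) to the same region up to diagonals.
   Hence, with (A_ij u)(eta, mu) the partial integral of Z_ij u,
     <v, P[N] u> = int g (A v)^T P (A u),
   which is symmetric in u and v and nonnegative for u = v. Well-posedness and
   x y <= x^2 + y^2 bound the integral of the absolute values, so the identity
   extends to signed integrands; it also gives int |w (P[N] u)_k| < oo for every
   w in L_2, and then P[N] u lies in L_2 because a function whose product with
   every L_2 function is integrable is itself in L_2. *)
Set Implicit Arguments.
Unset Strict Implicit.
Unset Printing Implicit Defensive.

Local Open Scope classical_set_scope.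
Local Open Scope ring_scope.

(** * One-dimensional layers: Dirac deltas and densities *)

(** Integrals in the statement are total: a divergent one has the value 0, and well-posedness makes
    the inner integrals converge only almost everywhere. Signed integrals are therefore never
    interchanged directly. Each iterated integral carries two $[0,+\infty]$-valued companions, the
    same iterated integral of the positive and of the negative part of its innermost integrand.
    These are defined and measurable everywhere, Tonelli acts on them, and finiteness has to be
    supplied only at the outermost level. The algebraic identities are arranged so that only
    constants cross an integral sign; hence they hold even at points of divergence. The data are
    unconstrained outside the rectangle, so $g$, $Z_{ij}$ and $u$ are multiplied by indicators. This
    gives joint measurability on the whole space and leaves the operator unchanged on the rectangle,
    because every delta occurring there is located inside it. The strict inequalities in $H$ and $I$
    meet the closed ranges of the operator; they differ on diagonals only, which are null when no
    delta is present, and the delta cases match exactly. *)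

Lemma measurable_fst_comp d d1 d2 (X : measurableType d)
    (Y : measurableType d1) (Y' : measurableType d2) (f : X -> Y * Y') :
  measurable_fun setT f -> measurable_fun setT (fun x => (f x).1).
Proof. exact: (measurableT_comp measurable_fst). Qed.

Lemma measurable_snd_comp d d1 d2 (X : measurableType d)
    (Y : measurableType d1) (Y' : measurableType d2) (f : X -> Y * Y') :
  measurable_fun setT f -> measurable_fun setT (fun x => (f x).2).
Proof. exact: (measurableT_comp measurable_snd). Qed.

Lemma measurable_comp2 d d1 d2 d3 (X : measurableType d)
    (Y1 : measurableType d1) (Y2 : measurableType d2) (Z : measurableType d3)
    (F : Y1 -> Y2 -> Z) (f1 : X -> Y1) (f2 : X -> Y2) :
  measurable_fun setT (fun z : Y1 * Y2 => F z.1 z.2) ->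
  measurable_fun setT f1 -> measurable_fun setT f2 ->
  measurable_fun setT (fun x => F (f1 x) (f2 x)).
Proof.
move=> mF m1 m2.
exact: (measurableT_comp mF (measurable_fun_pair m1 m2)).
Qed.

Lemma measurable_comp3 d d1 d2 d3 d4 (X : measurableType d)
    (Y1 : measurableType d1) (Y2 : measurableType d2) (Y3 : measurableType d3)
    (Z : measurableType d4)
    (F : Y1 -> Y2 -> Y3 -> Z) (f1 : X -> Y1) (f2 : X -> Y2) (f3 : X -> Y3) :
  measurable_fun setT (fun z : Y1 * Y2 * Y3 => F z.1.1 z.1.2 z.2) ->
  measurable_fun setT f1 -> measurable_fun setT f2 -> measurable_fun setT f3 ->
  measurable_fun setT (fun x => F (f1 x) (f2 x) (f3 x)).
Proof.
move=> mF m1 m2 m3.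
exact: (measurableT_comp mF (measurable_fun_pair (measurable_fun_pair m1 m2) m3)).
Qed.

Lemma measurable_comp4 d d1 d2 d3 d4 d5 (X : measurableType d)
    (Y1 : measurableType d1) (Y2 : measurableType d2) (Y3 : measurableType d3)
    (Y4 : measurableType d4) (Z : measurableType d5)
    (F : Y1 -> Y2 -> Y3 -> Y4 -> Z)
    (f1 : X -> Y1) (f2 : X -> Y2) (f3 : X -> Y3) (f4 : X -> Y4) :
  measurable_fun setT (fun z : Y1 * Y2 * Y3 * Y4 => F z.1.1.1 z.1.1.2 z.1.2 z.2) ->
  measurable_fun setT f1 -> measurable_fun setT f2 -> measurable_fun setT f3 ->
  measurable_fun setT f4 ->
  measurable_fun setT (fun x => F (f1 x) (f2 x) (f3 x) (f4 x)).
Proof.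
move=> mF m1 m2 m3 m4.
exact: (measurableT_comp mF (measurable_fun_pair (measurable_fun_pair
  (measurable_fun_pair m1 m2) m3) m4)).
Qed.

Lemma measurable_comp6 d d1 d2 d3 d4 d5 d6 d7 (X : measurableType d)
    (Y1 : measurableType d1) (Y2 : measurableType d2) (Y3 : measurableType d3)
    (Y4 : measurableType d4) (Y5 : measurableType d5) (Y6 : measurableType d6)
    (Z : measurableType d7)
    (F : Y1 -> Y2 -> Y3 -> Y4 -> Y5 -> Y6 -> Z)
    (f1 : X -> Y1) (f2 : X -> Y2) (f3 : X -> Y3)
    (f4 : X -> Y4) (f5 : X -> Y5) (f6 : X -> Y6) :
  measurable_fun setT (fun z : Y1 * Y2 * Y3 * Y4 * Y5 * Y6 =>
    F z.1.1.1.1.1 z.1.1.1.1.2 z.1.1.1.2 z.1.1.2 z.1.2 z.2) ->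
  measurable_fun setT f1 -> measurable_fun setT f2 -> measurable_fun setT f3 ->
  measurable_fun setT f4 -> measurable_fun setT f5 -> measurable_fun setT f6 ->
  measurable_fun setT (fun x => F (f1 x) (f2 x) (f3 x) (f4 x) (f5 x) (f6 x)).
Proof.
move=> mF m1 m2 m3 m4 m5 m6.
exact: (measurableT_comp mF (measurable_fun_pair (measurable_fun_pair
  (measurable_fun_pair (measurable_fun_pair (measurable_fun_pair m1 m2) m3) m4) m5) m6)).
Qed.

Ltac mproj := solve [repeat first
  [ exact: measurable_id | exact: measurable_cst
  | apply: measurable_fst_comp | apply: measurable_snd_comp ]].

Section egint.
Context {R : realType}.
Implicit Types (al be : R) (psi : gfun R) (f g : R -> \bar R).
Local Notation leb := (@lebesgue_measure R).

(** The indicator enters as a factor rather than as a domain, so that all integrals run over the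
    line and measurability is always on [setT]. *)
Definition itvw al be (s : R) : R := if (al <= s) && (s <= be) then 1 else 0.

(* [gint] for integrands with values in [0, +oo]. *)
Definition egint al be psi f : \bar R :=
  match psi with
  | GDelta p => f p
  | GFun h => (\int[leb]_s ((itvw al be s * h s)%:E * f s))%E
  end.

Definition gpos psi := if psi is GFun h then
  measurable_fun setT h /\ forall s, 0 <= h s else True.

(** The kind of layer, delta or density, is uniform over a family: the families below have fixed
    indices, and these decide the kind. This makes [measurable_egint] a two-case argument,
    composition for deltas and Tonelli for densities. *)
Definition mgfun d (X : measurableType d) (psi : X -> gfun R) :=
  (exists2 p : X -> R, measurable_fun setT p & forall x, psi x = GDelta (p x)) \/
  (exists h : X -> R -> R,
     [/\ measurable_fun setT (fun z : X * R => h z.1 z.2),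
         forall x s, 0 <= h x s & forall x, psi x = GFun (h x)]).

Lemma mgfun_gpos d (X : measurableType d) (psi : X -> gfun R) x :
  mgfun psi -> gpos (psi x).
Proof.
case=> [[p mp ->]//|[h [mh h0 ->]]]; split => //.
by apply: (measurable_comp2 mh); mproj.
Qed.

Lemma mgfun_comp d d' (X : measurableType d) (Y : measurableType d')
    (psi : X -> gfun R) (f : Y -> X) :
  measurable_fun setT f -> mgfun psi -> mgfun (fun y => psi (f y)).
Proof.
move=> mf [[p mp E]|[h [mh h0 E]]]; [left|right].
  by exists (p \o f) => //=; exact: measurableT_comp.
exists (fun y => h (f y)); split => //.
apply: (measurable_comp2 mh); last by mproj.
exact: measurableT_comp.
Qed.

Lemma itvw_ge0 al be s : 0 <= itvw al be s.
Proof. by rewrite /itvw; case: ifP. Qed.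

Lemma measurable_itvw al be : measurable_fun setT (itvw al be).
Proof.
apply: measurable_fun_ifT; [|exact: measurable_cst|exact: measurable_cst].
by apply: measurable_and; apply: measurable_fun_ler; mproj.
Qed.

Lemma measurable_wgt d (X : measurableType d) al be (h : X -> R) (f : X -> \bar R)
    (k : X -> R) :
  measurable_fun setT h -> measurable_fun setT f -> measurable_fun setT k ->
  measurable_fun setT (fun x => (itvw al be (k x) * h x)%:E * f x)%E.
Proof.
move=> mh mf mk; apply: emeasurable_funM => //.
apply/measurable_EFinP; apply: measurable_funM => //.
exact: (measurableT_comp (measurable_itvw al be)).
Qed.

Lemma wgt_ge0 al be s (c : R) (x : \bar R) : 0 <= c -> (0 <= x)%E ->
  (0 <= (itvw al be s * c)%:E * x)%E.
Proof. by move=> c0 x0; rewrite mule_ge0// lee_fin mulr_ge0// itvw_ge0. Qed.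

Lemma egint_ge0 al be psi f :
  gpos psi -> (forall s, 0 <= f s)%E -> (0 <= egint al be psi f)%E.
Proof.
case: psi => [p _ f0//|h [mh h0] f0] /=; first exact: f0.
by apply: integral_ge0 => s _; exact: wgt_ge0.
Qed.

Lemma eq_egint al be psi f g : f =1 g -> egint al be psi f = egint al be psi g.
Proof. by move=> /funext ->. Qed.

Lemma eq_itv_egint al be psi f g :
  (if psi is GDelta p then f p = g p else True) ->
  (forall s, al <= s -> s <= be -> f s = g s) ->
  egint al be psi f = egint al be psi g.
Proof.
case: psi => [p//|h] _ fg /=; apply: eq_integral => s _; rewrite /itvw.
case: ifPn => [/andP[? ?]|_]; first by rewrite fg.
by rewrite mul0r !mul0e.
Qed.

Lemma egint_sum al be psi (I : Type) (r : seq I) (f : I -> R -> \bar R) :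
  gpos psi -> (forall i, measurable_fun setT (f i)) ->
  (forall i s, 0 <= f i s)%E ->
  egint al be psi (fun s => (\sum_(i <- r) f i s)%E) =
  (\sum_(i <- r) egint al be psi (f i))%E.
Proof.
case: psi => [p//|h [mh h0] mf f0] /=.
rewrite -ge0_integral_sum//; last 2 first.
- by move=> i; apply: measurable_wgt; [exact: mh|exact: mf|mproj].
- by move=> i s _; exact: wgt_ge0.
by apply: eq_integral => s _; rewrite ge0_sume_distrr.
Qed.

Lemma egintZ al be psi f (k : \bar R) :
  gpos psi -> measurable_fun setT f -> (forall s, 0 <= f s)%E -> (0 <= k)%E ->
  egint al be psi (fun s => k * f s)%E = (k * egint al be psi f)%E.
Proof.
case: psi => [p//|h [mh h0] mf f0 k0] /=.
rewrite -ge0_integralZl//; last 2 first.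
- by apply: measurable_wgt => //; mproj.
- by move=> s _; exact: wgt_ge0.
by apply: eq_integral => s _; rewrite muleCA.
Qed.

Lemma le_egint al be psi f g :
  gpos psi -> measurable_fun setT f -> measurable_fun setT g ->
  (forall s, 0 <= f s)%E -> (forall s, f s <= g s)%E ->
  (egint al be psi f <= egint al be psi g)%E.
Proof.
case: psi => [p _ _ _ _ fg|h [mh h0] mf mg f0 fg] /=; first exact: fg.
apply: ge0_le_integral => //.
- by move=> s _; exact: wgt_ge0.
- by apply: measurable_wgt => //; mproj.
- by apply: measurable_wgt => //; mproj.
- by move=> s _; rewrite lee_wpmul2l// lee_fin mulr_ge0// itvw_ge0.
Qed.

Lemma measurable_egint d (X : measurableType d) al be (psi : X -> gfun R)
    (F : X -> R -> \bar R) :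
  mgfun psi -> measurable_fun setT (fun z : X * R => F z.1 z.2) ->
  (forall x s, 0 <= F x s)%E ->
  measurable_fun setT (fun x => egint al be (psi x) (F x)).
Proof.
move=> [[p mp E]|[h [mh h0 E]]] mF F0.
  rewrite (_ : (fun x => _) = (fun x => F x (p x))); last first.
    by apply/funext => x; rewrite E.
  by apply: (measurable_comp2 mF) => //; mproj.
rewrite (_ : (fun x => _) = fubini_F leb
  (fun z : X * R => ((itvw al be z.2 * h z.1 z.2)%:E * F z.1 z.2)%E)); last first.
  by apply/funext => x; rewrite E.
apply: measurable_fun_fubini_tonelli_F.
  by apply: measurable_wgt => //; mproj.
by move=> z; exact: wgt_ge0.
Qed.

(** Two densities commute by Tonelli; if either layer is a delta, both sides are the same
    evaluation. *)
Lemma egint_swap al be al' be' psi psi' (F : R -> R -> \bar R) :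
  gpos psi -> gpos psi' ->
  measurable_fun setT (fun z : R * R => F z.1 z.2) ->
  (forall s t, 0 <= F s t)%E ->
  egint al be psi (fun s => egint al' be' psi' (F s)) =
  egint al' be' psi' (fun t => egint al be psi (F^~ t)).
Proof.
case: psi => [p|h] gp; first by case: psi'.
case: psi' => [p'|h'] gp' mF F0; first by [].
rewrite /egint.
move: gp gp' => [mh h0] [mh' h'0].
pose G (z : R * R) := ((itvw al be z.1 * h z.1)%:E *
  ((itvw al' be' z.2 * h' z.2)%:E * F z.1 z.2))%E.
have mG : measurable_fun setT G.
  apply: measurable_wgt; [|apply: measurable_wgt => //|]; try by mproj.
  - by apply: (measurableT_comp mh); mproj.
  - by apply: (measurableT_comp mh'); mproj.
have G0 z : (0 <= G z)%E by rewrite !wgt_ge0.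
transitivity (\int[leb]_s \int[leb]_t G (s, t))%E.
  apply: eq_integral => s _; rewrite -ge0_integralZl//.
  - apply: measurable_wgt => //; try by mproj.
    by apply: (measurable_comp2 mF); mproj.
  - by move=> t _; exact: wgt_ge0.
  - by rewrite lee_fin mulr_ge0// itvw_ge0.
transitivity (\int[leb]_t \int[leb]_s G (s, t))%E.
  exact: (@fubini_tonelli _ _ _ _ R leb leb G mG G0).
apply: eq_integral => t _.
rewrite -ge0_integralZl//; last 3 first.
- apply: measurable_wgt => //; try by mproj.
  by apply: (measurable_comp2 mF); mproj.
- by move=> s _; exact: wgt_ge0.
- by rewrite lee_fin mulr_ge0// itvw_ge0.
by apply: eq_integral => s _; rewrite /G muleCA.
Qed.

End egint.

(** * Reordering the layers of one variable *)

Section egint_order.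
Context {R : realType}.
Variables al be : R.
Implicit Types (F : R -> R -> R -> \bar R).
Local Notation leb := (@lebesgue_measure R).
Local Notation E := (egint al be).

(** Lebesgue measure on the interval as a layer, so that the outer integrations obey the same rules
    as the inner ones. *)
Definition gunit : gfun R := GFun (fun=> 1).

Lemma unit_gpos : gpos gunit.
Proof. by split => //; exact: measurable_cst. Qed.

Lemma mgfun_unit d (X : measurableType d) : mgfun (fun _ : X => gunit).
Proof. by right; exists (fun _ _ => 1); split => //; exact: measurable_cst. Qed.

Lemma egint_GFun (h : R -> R) f : (forall s, 0 <= h s) ->
  E (GFun h) f = E gunit (fun s => (h s)%:E * f s)%E.
Proof.
move=> h0; apply: eq_integral => s _.
by rewrite mulr1 EFinM muleA.
Qed.

Lemma egintD psi (f g : R -> \bar R) : gpos psi ->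
  measurable_fun setT f -> (forall s, 0 <= f s)%E ->
  measurable_fun setT g -> (forall s, 0 <= g s)%E ->
  E psi (fun s => f s + g s)%E = (E psi f + E psi g)%E.
Proof.
case: psi => [//|h] [mh h0] mf f0 mg g0 /=.
rewrite -ge0_integralD//.
- by apply: eq_integral => s _; rewrite ge0_muleDr.
- by move=> s _; exact: wgt_ge0.
- by apply: measurable_wgt => //; mproj.
- by move=> s _; exact: wgt_ge0.
- by apply: measurable_wgt => //; mproj.
Qed.

(** With the other variables among $\eta, x, t$ fixed, the diagonals cut the remaining line in at
    most two points, which is all that has to be ignored. *)
Lemma egint_unit_ext2 (p q : R) (f g : R -> \bar R) :
  measurable_fun setT f -> (forall s, 0 <= f s)%E ->
  measurable_fun setT g -> (forall s, 0 <= g s)%E ->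
  (forall s, s != p -> s != q -> f s = g s) ->
  E gunit f = E gunit g.
Proof.
move=> mf f0 mg g0 fg; rewrite /egint /=.
apply: (@ge0_ae_eq_integral _ _ _ leb).
- by [].
- by apply: measurable_wgt => //; mproj.
- by apply: measurable_wgt => //; mproj.
- by move=> s _; exact: wgt_ge0.
- by move=> s _; exact: wgt_ge0.
exists [set p; q]; split.
- by apply: measurableU.
- apply: countable_lebesgue_measure0.
  by apply: finite_set_countable; rewrite finite_setU; split; exact: finite_set1.
- move=> s /= /not_implyP[_ /eqP H].
  case: (eqVneq s p) => [->|sp]; first by left.
  case: (eqVneq s q) => [->|sq]; first by right.
  by move: H; rewrite fg ?eqxx.
Qed.

(** Common form of both orders of integration when no delta is present: Lebesgue measure in all
    three variables, with the region encoded in the weight [W]. Equality of the two orders then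
    becomes equality of weights. *)
Definition triple (W : R -> R -> R -> R) F : \bar R :=
  E gunit (fun eta => E gunit (fun x => E gunit (fun t =>
    (W x t eta)%:E * F eta x t))%E).

Section with_F.
Variable F : R -> R -> R -> \bar R.
Hypothesis mF : measurable_fun setT (fun z : R * R * R => F z.1.1 z.1.2 z.2).
Hypothesis F0 : forall eta x t, (0 <= F eta x t)%E.

Definition wgt3 (W : R -> R -> R -> R) :=
  measurable_fun setT (fun z : R * R * R => W z.1.1 z.1.2 z.2) /\
  forall x t eta, 0 <= W x t eta.

Lemma wgt3_ge0 W x t eta : wgt3 W -> (0 <= (W x t eta)%:E * F eta x t)%E.
Proof. by case=> _ W0; rewrite mule_ge0// lee_fin. Qed.

Lemma measurable_wgt3 d (X : measurableType d) W (f1 f2 f3 : X -> R) : wgt3 W ->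
  measurable_fun setT f1 -> measurable_fun setT f2 -> measurable_fun setT f3 ->
  measurable_fun setT (fun z => (W (f1 z) (f2 z) (f3 z))%:E * F (f3 z) (f1 z) (f2 z))%E.
Proof.
case=> mW _ m1 m2 m3; apply: emeasurable_funM; last exact: (measurable_comp3 mF).
by apply/measurable_EFinP; exact: (measurable_comp3 mW).
Qed.

Lemma tripleD W W' : wgt3 W -> wgt3 W' ->
  (triple W F + triple W' F)%E = triple (fun x t eta => W x t eta + W' x t eta) F.
Proof.
move=> w w'; have g1 := unit_gpos; rewrite /triple -egintD//.
- apply: eq_egint => eta; rewrite -egintD//.
  + apply: eq_egint => x; rewrite -egintD//.
    * by apply: eq_egint => t; rewrite EFinD ge0_muleDl// lee_fin; [exact: w.2|exact: w'.2].
    * by apply: measurable_wgt3 => //; mproj.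
    * by move=> t; exact: wgt3_ge0.
    * by apply: measurable_wgt3 => //; mproj.
    * by move=> t; exact: wgt3_ge0.
  + apply: measurable_egint; first exact: mgfun_unit.
    * by apply: measurable_wgt3 => //; mproj.
    * by move=> x t; exact: wgt3_ge0.
  + by move=> x; apply: egint_ge0 => // t; exact: wgt3_ge0.
  + apply: measurable_egint; first exact: mgfun_unit.
    * by apply: measurable_wgt3 => //; mproj.
    * by move=> x t; exact: wgt3_ge0.
  + by move=> x; apply: egint_ge0 => // t; exact: wgt3_ge0.
- apply: measurable_egint; first exact: mgfun_unit.
  + apply: measurable_egint; first exact: mgfun_unit.
    * by apply: measurable_wgt3 => //; mproj.
    * by move=> x t; exact: wgt3_ge0.
  + by move=> x s; apply: egint_ge0 => // t; exact: wgt3_ge0.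
- by move=> s; apply: egint_ge0 => // x; apply: egint_ge0 => // t; exact: wgt3_ge0.
- apply: measurable_egint; first exact: mgfun_unit.
  + apply: measurable_egint; first exact: mgfun_unit.
    * by apply: measurable_wgt3 => //; mproj.
    * by move=> x t; exact: wgt3_ge0.
  + by move=> x s; apply: egint_ge0 => // t; exact: wgt3_ge0.
- by move=> s; apply: egint_ge0 => // x; apply: egint_ge0 => // t; exact: wgt3_ge0.
Qed.

Lemma eq_triple W W' : wgt3 W -> wgt3 W' ->
  (forall x t eta, x != t -> x != eta -> t != eta -> W x t eta = W' x t eta) ->
  triple W F = triple W' F.
Proof.
move=> w w' WW'; apply: eq_egint => eta.
(* In $x$ only $x=\eta$ is exceptional; in $t$, both $t=x$ and $t=\eta$ are. *)
apply: (@egint_unit_ext2 eta eta).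
- apply: measurable_egint; first exact: mgfun_unit.
    by apply: measurable_wgt3 => //; mproj.
  by move=> x t; exact: wgt3_ge0.
- by move=> x; apply: egint_ge0 => [|t]; [exact: unit_gpos|exact: wgt3_ge0].
- apply: measurable_egint; first exact: mgfun_unit.
    by apply: measurable_wgt3 => //; mproj.
  by move=> x t; exact: wgt3_ge0.
- by move=> x; apply: egint_ge0 => [|t]; [exact: unit_gpos|exact: wgt3_ge0].
move=> x xeta _; apply: (@egint_unit_ext2 x eta).
- by apply: measurable_wgt3 => //; mproj.
- by move=> t; exact: wgt3_ge0.
- by apply: measurable_wgt3 => //; mproj.
- by move=> t; exact: wgt3_ge0.
by move=> t tx te; rewrite WW'// eq_sym.
Qed.

Lemma egint3_tripler (a c : R -> R -> R) :
  measurable_fun setT (fun z : R * R => a z.1 z.2) ->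
  measurable_fun setT (fun z : R * R => c z.1 z.2) ->
  (forall s t, 0 <= a s t) -> (forall s t, 0 <= c s t) ->
  E gunit (fun eta => E (GFun (a eta)) (fun x => E (GFun (c eta)) (fun t => F eta x t)))
  = triple (fun x t eta => a eta x * c eta t) F.
Proof.
move=> ma mc a0 c0; have g1 := unit_gpos; apply: eq_egint => eta.
rewrite egint_GFun//; apply: eq_egint => x; rewrite egint_GFun//.
rewrite -egintZ// ?lee_fin//.
- by apply: eq_egint => t; rewrite EFinM muleA.
- apply: emeasurable_funM; last by apply: (measurable_comp3 mF); mproj.
  by apply/measurable_EFinP; apply: (measurable_comp2 mc); mproj.
- by move=> s; rewrite mule_ge0// lee_fin.
Qed.

(** Here $\eta$ is innermost, as in the kernels of [LPI]; two swaps, past $t$ and then past $x$,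
    bring it outside. *)
Lemma egint3_triplel (a : R -> R -> R) (c : R -> R -> R -> R) :
  measurable_fun setT (fun z : R * R => a z.1 z.2) ->
  measurable_fun setT (fun z : R * R * R => c z.1.1 z.1.2 z.2) ->
  (forall s t, 0 <= a s t) -> (forall s t r, 0 <= c s t r) ->
  E gunit (fun x => E (GFun (a x)) (fun t => E (GFun (c x t)) (fun eta => F eta x t)))
  = triple (fun x t eta => a x t * c x t eta) F.
Proof.
move=> ma mc a0 c0; have g1 := unit_gpos.
pose W x t eta := a x t * c x t eta.
have w : wgt3 W.
  split; last by move=> *; rewrite mulr_ge0.
  apply: measurable_funM; last by apply: (measurable_comp3 mc); mproj.
  by apply: (measurable_comp2 ma); mproj.
have wF x t eta : (0 <= (W x t eta)%:E * F eta x t)%E by exact: wgt3_ge0.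
transitivity (E gunit (fun x => E gunit (fun t => E gunit (fun eta =>
    (W x t eta)%:E * F eta x t)%E))).
  apply: eq_egint => x.
  rewrite egint_GFun//; apply: eq_egint => t; rewrite egint_GFun//.
  rewrite -egintZ// ?lee_fin//.
  - by apply: eq_egint => eta; rewrite EFinM muleA.
  - apply: emeasurable_funM; last by apply: (measurable_comp3 mF); mproj.
    by apply/measurable_EFinP; apply: (measurable_comp3 mc); mproj.
  - by move=> s; rewrite mule_ge0// lee_fin.
transitivity (E gunit (fun x => E gunit (fun eta => E gunit (fun t =>
    (W x t eta)%:E * F eta x t)%E))).
  apply: eq_egint => x; apply: egint_swap => //.
  by apply: measurable_wgt3 => //; mproj.
apply: egint_swap => //.
- apply: measurable_egint => //; first exact: mgfun_unit.
  by apply: measurable_wgt3 => //; mproj.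
- by move=> x t; apply: egint_ge0.
Qed.

End with_F.
End egint_order.

Section Psi_order.
Context {R : realType}.
Variables al be : R.
Local Notation E := (egint al be).

(* The layers of [epart] and of [PI_op] in the form of a [gfun], so that they
   can be treated together with those of [Psi]. *)
Definition part_gfun (k : nat) (xi : R) : gfun R :=
  match k with
  | 0 => GDelta xi
  | 1 => GFun (fun s => if (s <= xi)%R then 1%R else 0%R)
  | _ => GFun (fun s => if (xi <= s)%R then 1%R else 0%R)
  end%N.

Ltac mite := apply: measurable_fun_ifT;
  [repeat apply: measurable_and; (apply: measurable_fun_ltr || apply: measurable_fun_ler); mproj
  |exact: measurable_cst|exact: measurable_cst].

Lemma mgfun_part k : mgfun (part_gfun k).
Proof.
case: k => [|[|k]]; first by left; exists id.
- right; exists (fun xi s => if s <= xi then 1 else 0); split => //.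
  + by mite.
  + by move=> *; case: ifP.
- right; exists (fun xi s => if xi <= s then 1 else 0); split => //.
  + by mite.
  + by move=> *; case: ifP.
Qed.

Lemma mgfun_Psi k i j : mgfun (fun z : R * R => Psi k i j z.1 z.2).
Proof.
have m0 : mgfun (fun _ : R * R => GFun (fun _ : R => 0 : R)).
  by right; exists (fun _ _ => 0); split => //; exact: measurable_cst.
have md1 : mgfun (fun z : R * R => GDelta z.1) by left; exists fst => //; mproj.
have md2 : mgfun (fun z : R * R => GDelta z.2) by left; exists snd => //; mproj.
case: k => [|[|[|k]]]; case: i => [|[|[|i]]]; case: j => [|[|[|j]]] //=.
- by right; exists (fun z s => H_fun z.1 s z.2); split => [|x s|//];
    rewrite /H_fun; [mite|case: ifP].
- by right; exists (fun z s => I_fun z.2 s); split => [|x s|//];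
    rewrite /I_fun; [mite|case: ifP].
- by right; exists (fun z s => I_fun s z.1); split => [|x s|//];
    rewrite /I_fun; [mite|case: ifP].
- by right; exists (fun z s => I_fun z.1 s); split => [|x s|//];
    rewrite /I_fun; [mite|case: ifP].
- by right; exists (fun z s => I_fun s z.2); split => [|x s|//];
    rewrite /I_fun; [mite|case: ifP].
- by right; exists (fun z s => H_fun z.2 s z.1); split => [|x s|//];
    rewrite /H_fun; [mite|case: ifP].
Qed.

Lemma egint0 psi : E psi (fun=> 0%E) = 0%E.
Proof.
case: psi => [//|h] /=; under eq_integral do rewrite mule0.
exact: integral0.
Qed.

Lemma egint_null (f : R -> \bar R) : E (GFun (fun=> 0)) f = 0%E.
Proof.
rewrite /=; under eq_integral do rewrite mulr0 mul0e.
exact: integral0.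
Qed.

Lemma egint_null2 psi (f : R -> R -> \bar R) :
  E psi (fun t => E (GFun (fun=> 0)) (f t)) = 0%E.
Proof.
rewrite (_ : (fun t => _) = fun=> 0%E) ?egint0//.
by apply/funext => t; exact: egint_null.
Qed.

Lemma egint_delta p (f : R -> \bar R) : E (GDelta p) f = f p.
Proof. by []. Qed.

Lemma sum3E (V : nmodType) (f : nat -> V) :
  \sum_(k < 3) f k = f 0%N + f 1%N + f 2%N.
Proof. by rewrite !big_ord_recr big_ord0 /= add0r. Qed.

Local Arguments egint : simpl never.

Variable F : R -> R -> R -> \bar R.
Hypothesis mF : measurable_fun setT (fun z : R * R * R => F z.1.1 z.1.2 z.2).
Hypothesis F0 : forall eta x t, (0 <= F eta x t)%E.

(** The case $(i,j)=(1,0)$: the delta sets $\eta=t$, and the triangle $t\le x$ is swept once along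
    $t$ and once along $x$. The next lemma is the mirror image, $(2,0)$. *)
Lemma egint_part_swapL :
  E gunit (fun x => E (part_gfun 1 x) (fun t => F t x t)) =
    E gunit (fun eta => E (part_gfun 2 eta) (fun x => F eta x eta)).
Proof.
have g1 : gpos (gunit : gfun R) by exact: unit_gpos.
transitivity (E gunit (fun x => E gunit (fun t =>
  (if t <= x then 1 else 0)%:E * F t x t)%E)).
  by apply: eq_egint => x; apply: egint_GFun => s; case: ifP.
transitivity (E gunit (fun t => E gunit (fun x =>
  (if t <= x then 1 else 0)%:E * F t x t)%E)).
  apply: egint_swap; [exact: g1|exact: g1| |].
    apply: emeasurable_funM; last by apply: (measurable_comp3 mF); mproj.
    by apply/measurable_EFinP; mite.
  by move=> s t; apply: mule_ge0; [case: ifP|exact: F0].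
by apply: eq_egint => t; apply/esym; apply: egint_GFun => s; case: ifP.
Qed.

Lemma egint_part_swapR :
  E gunit (fun x => E (part_gfun 2 x) (fun t => F t x t)) =
    E gunit (fun eta => E (part_gfun 1 eta) (fun x => F eta x eta)).
Proof.
have g1 : gpos (gunit : gfun R) by exact: unit_gpos.
transitivity (E gunit (fun x => E gunit (fun t =>
  (if x <= t then 1 else 0)%:E * F t x t)%E)).
  by apply: eq_egint => x; apply: egint_GFun => s; case: ifP.
transitivity (E gunit (fun t => E gunit (fun x =>
  (if x <= t then 1 else 0)%:E * F t x t)%E)).
  apply: egint_swap; [exact: g1|exact: g1| |].
    apply: emeasurable_funM; last by apply: (measurable_comp3 mF); mproj.
    by apply/measurable_EFinP; mite.
  by move=> s t; apply: mule_ge0; [case: ifP|exact: F0].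
by apply: eq_egint => t; apply/esym; apply: egint_GFun => s; case: ifP.
Qed.

Definition wgt2 (a : R -> R -> R) :=
  measurable_fun setT (fun z : R * R => a z.1 z.2) /\ forall s t, 0 <= a s t.

Lemma wgt3_mulr (a c : R -> R -> R) : wgt2 a -> wgt2 c ->
  wgt3 (fun x t eta => a eta x * c eta t).
Proof.
move=> [ma a0] [mc c0]; split; last by move=> *; rewrite mulr_ge0.
apply: measurable_funM; first by apply: (measurable_comp2 ma); mproj.
by apply: (measurable_comp2 mc); mproj.
Qed.

Lemma wgt3_mull (a : R -> R -> R) (c : R -> R -> R -> R) : wgt2 a -> wgt3 c ->
  wgt3 (fun x t eta => a x t * c x t eta).
Proof.
move=> [ma a0] [mc c0]; split; last by move=> *; rewrite mulr_ge0.
apply: measurable_funM; first by apply: (measurable_comp2 ma); mproj.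
exact: mc.
Qed.

(** Used for $x$ and $t$ on opposite sides of $\eta$: their order is then forced, and a single $k$
    contributes. *)
Lemma egint3_reorder1 (a : R -> R -> R) (c : R -> R -> R -> R) (a' c' : R -> R -> R) :
  wgt2 a -> wgt3 c -> wgt2 a' -> wgt2 c' ->
  (forall x t eta, x != t -> x != eta -> t != eta ->
    a x t * c x t eta = a' eta x * c' eta t) ->
  E gunit (fun x => E (GFun (a x)) (fun t => E (GFun (c x t)) (fun eta => F eta x t)))
  = E gunit (fun eta => E (GFun (a' eta)) (fun x => E (GFun (c' eta)) (fun t => F eta x t))).
Proof.
move=> wa wc wa' wc' H.
transitivity (triple al be (fun x t eta => a x t * c x t eta) F).
  by apply: egint3_triplel; [exact: mF|exact: F0|exact: wa.1|exact: wc.1|exact: wa.2|exact: wc.2].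
transitivity (triple al be (fun x t eta => a' eta x * c' eta t) F).
  by apply: eq_triple; [exact: mF|exact: F0|exact: wgt3_mull|exact: wgt3_mulr|exact: H].
apply/esym; apply: egint3_tripler;
  [exact: mF|exact: F0|exact: wa'.1|exact: wc'.1|exact: wa'.2|exact: wc'.2].
Qed.

Lemma mgfun_GFun d (X : measurableType d) (h : X -> R -> R) :
  measurable_fun setT (fun z : X * R => h z.1 z.2) -> (forall x s, 0 <= h x s) ->
  mgfun (fun x => GFun (h x)).
Proof. by move=> mh h0; right; exists h. Qed.

Lemma measurable_egint2 (a : R -> R -> R) (c : R -> R -> R -> R) :
  wgt2 a -> wgt3 c -> measurable_fun setT
    (fun x => E (GFun (a x)) (fun t => E (GFun (c x t)) (fun eta => F eta x t))).
Proof.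
move=> [ma a0] [mc c0]; apply: measurable_egint.
- exact: mgfun_GFun.
- apply: (@measurable_egint R _ _ al be (fun z => GFun (c z.1 z.2))
    (fun z eta => F eta z.1 z.2)).
  + exact: mgfun_GFun.
  + by apply: (measurable_comp3 mF); mproj.
  + by move=> *; exact: F0.
- move=> x t; apply: egint_ge0; last by move=> *; exact: F0.
  by split; [apply: (measurable_comp3 mc); mproj|].
Qed.

(** Used for $x$ and $t$ on the same side of $\eta$: both orders $t<x$ and $x<t$ occur, they come
    from $k=1$ and $k=2$, and their weights add up to the one on the right. *)
Lemma egint3_reorder2 (a b : R -> R -> R) (c e : R -> R -> R -> R) (a' c' : R -> R -> R) :
  wgt2 a -> wgt3 c -> wgt2 b -> wgt3 e -> wgt2 a' -> wgt2 c' ->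
  (forall x t eta, x != t -> x != eta -> t != eta ->
    a x t * c x t eta + b x t * e x t eta = a' eta x * c' eta t) ->
  E gunit (fun x =>
    (E (GFun (a x)) (fun t => E (GFun (c x t)) (fun eta => F eta x t)) +
     E (GFun (b x)) (fun t => E (GFun (e x t)) (fun eta => F eta x t)))%E)
  = E gunit (fun eta => E (GFun (a' eta)) (fun x => E (GFun (c' eta)) (fun t => F eta x t))).
Proof.
move=> wa wc wb we wa' wc' H.
have E0 f g x : wgt2 f -> wgt3 g ->
    (0 <= E (GFun (f x)) (fun t => E (GFun (g x t)) (fun eta => F eta x t)))%E.
  move=> [mf f0] [mg g0]; apply: egint_ge0.
    by split; [apply: (measurable_comp2 mf); mproj|].
  move=> s; apply: egint_ge0; last by move=> *; exact: F0.
  by split; [apply: (measurable_comp3 mg); mproj|].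
transitivity (E gunit (fun x => E (GFun (a x)) (fun t => E (GFun (c x t)) (fun eta => F eta x t)))
  + E gunit (fun x => E (GFun (b x)) (fun t => E (GFun (e x t)) (fun eta => F eta x t))))%E.
  apply: egintD; [exact: unit_gpos|exact: measurable_egint2|by move=> x; exact: E0
  |exact: measurable_egint2|by move=> x; exact: E0].
transitivity (triple al be (fun x t eta => a x t * c x t eta)%R F +
  triple al be (fun x t eta => b x t * e x t eta)%R F)%E.
  apply: (congr2 adde); apply: egint3_triplel;
    [exact: mF|exact: F0|exact: wa.1|exact: wc.1|exact: wa.2|exact: wc.2
    |exact: mF|exact: F0|exact: wb.1|exact: we.1|exact: wb.2|exact: we.2].
transitivity (triple al be (fun x t eta => a x t * c x t eta + b x t * e x t eta) F).
  by apply: tripleD; [exact: mF|exact: F0|exact: wgt3_mull|exact: wgt3_mull].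
transitivity (triple al be (fun x t eta => a' eta x * c' eta t) F).
  apply: eq_triple; [exact: mF|exact: F0| |exact: wgt3_mulr|exact: H].
  split.
  - by apply: measurable_funD; [case: (wgt3_mull wa wc)|case: (wgt3_mull wb we)].
  - by move=> x t eta; rewrite addr_ge0//; [case: (wgt3_mull wa wc)|case: (wgt3_mull wb we)].
apply/esym; apply: egint3_tripler;
  [exact: mF|exact: F0|exact: wa'.1|exact: wc'.1|exact: wa'.2|exact: wc'.2].
Qed.

Ltac mwgt := split => [|*]; rewrite /H_fun /I_fun /=; [mite|by case: ifP].
Ltac offdiag := let x := fresh "x" in let t := fresh "t" in let eta := fresh "eta" in
  move=> x t eta; rewrite /H_fun /I_fun;
  case: (ltgtP x t) => //; case: (ltgtP x eta) => //; case: (ltgtP t eta) => //=;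
  rewrite ?(mulr0, mulr1, addr0, add0r) //; lra.

(** This identity is what the table [Psi] encodes: $k$ places $t$ relative to $x$, and [Psi]
    supplies the matching constraint on $\eta$. The bar is a change of viewpoint: $i$ locates $\eta$
    as seen from $x$, so seen from $\eta$ the variable $x$ lies on the side $\bar i$. *)
Lemma egint_Psi_reorder i j : (i < 3)%N -> (j < 3)%N ->
  E (gunit : gfun R) (fun x => (\sum_(k < 3) E (part_gfun k x) (fun t =>
    E (Psi k i j x t) (fun eta => F eta x t)))%E) =
  E gunit (fun eta => E (part_gfun (bar i) eta) (fun x =>
    E (part_gfun j eta) (fun t => F eta x t))).
Proof.
move=> i3 j3.
have g1 : gpos (gunit : gfun R) by exact: unit_gpos.
transitivity (E gunit (fun x =>
    E (part_gfun 0 x) (fun t => E (Psi 0 i j x t) (fun eta => F eta x t)) +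
    E (part_gfun 1 x) (fun t => E (Psi 1 i j x t) (fun eta => F eta x t)) +
    E (part_gfun 2 x) (fun t => E (Psi 2 i j x t) (fun eta => F eta x t)))%E).
  apply: eq_egint => x.
  exact: (sum3E (fun k => E (part_gfun k x) (fun t =>
    E (Psi k i j x t) (fun eta => F eta x t)))).
case: i i3 => [|[|[|//]]] _; case: j j3 => [|[|[|//]]] _ /=.
(* For $i=0$ the delta sets $\eta=x$ and only $k=j$ survives. *)
- by apply: eq_egint => x; rewrite !egint_null2 !adde0 !egint_delta.
- by apply: eq_egint => x; rewrite !egint_null2 !egint_delta add0e adde0.
- by apply: eq_egint => x; rewrite !egint_null2 !egint_delta !add0e.
- by rewrite -egint_part_swapL; apply: eq_egint => x; rewrite !egint_null2 add0e adde0.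
- transitivity (E gunit (fun x => E (part_gfun 1 x)
    (fun t => E (Psi 1 1 1 x t) (fun eta => F eta x t)))).
    by apply: eq_egint => x; rewrite !egint_null2 add0e adde0.
  by apply: egint3_reorder1; [mwgt|mwgt|mwgt|mwgt|offdiag].
- transitivity (E gunit (fun x => (E (part_gfun 1 x)
    (fun t => E (Psi 1 1 2 x t) (fun eta => F eta x t)) +
    E (part_gfun 2 x) (fun t => E (Psi 2 1 2 x t) (fun eta => F eta x t)))%E)).
    by apply: eq_egint => x; rewrite !egint_null2 add0e.
  by apply: egint3_reorder2; [mwgt|mwgt|mwgt|mwgt|mwgt|mwgt|offdiag].
- by rewrite -egint_part_swapR; apply: eq_egint => x; rewrite !egint_null2 !add0e.
- transitivity (E gunit (fun x => (E (part_gfun 1 x)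
    (fun t => E (Psi 1 2 1 x t) (fun eta => F eta x t)) +
    E (part_gfun 2 x) (fun t => E (Psi 2 2 1 x t) (fun eta => F eta x t)))%E)).
    by apply: eq_egint => x; rewrite !egint_null2 add0e.
  by apply: egint3_reorder2; [mwgt|mwgt|mwgt|mwgt|mwgt|mwgt|offdiag].
- transitivity (E gunit (fun x => E (part_gfun 2 x)
    (fun t => E (Psi 2 2 2 x t) (fun eta => F eta x t)))).
    by apply: eq_egint => x; rewrite !egint_null2 !add0e.
  by apply: egint3_reorder1; [mwgt|mwgt|mwgt|mwgt|offdiag].
Qed.

End Psi_order.

(** * Reordering the layers of both variables *)

Section gfun_families.
Context {R : realType}.

Lemma mgfun_part_comp d' (X : measurableType d') k (f : X -> R) :
  measurable_fun setT f -> mgfun (fun x => part_gfun k (f x)).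
Proof. by move=> mf; apply: mgfun_comp => //; exact: mgfun_part. Qed.

Lemma mgfun_Psi_comp d' (X : measurableType d') k i j (f g : X -> R) :
  measurable_fun setT f -> measurable_fun setT g ->
  mgfun (fun x => Psi k i j (f x) (g x)).
Proof.
move=> mf mg.
exact: (mgfun_comp (measurable_fun_pair mf mg) (mgfun_Psi k i j)).
Qed.

Lemma part_gpos k (xi : R) : gpos (part_gfun k xi).
Proof. exact: (mgfun_gpos xi (mgfun_part k)). Qed.

Lemma Psi_gpos k i j (xi tau : R) : gpos (Psi k i j xi tau).
Proof. exact: (mgfun_gpos (xi, tau) (mgfun_Psi k i j)). Qed.

End gfun_families.

Ltac gp := first [exact: unit_gpos|exact: part_gpos|exact: Psi_gpos].
Ltac mgf := first [exact: mgfun_unit|apply: mgfun_part_comp; mproj|apply: mgfun_Psi_comp; mproj].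

Section order2.
Context {R : realType}.
Variables a b c d : R.

Local Arguments egint : simpl never.

Variable F : R -> R -> R -> R -> R -> R -> \bar R.
Hypothesis mF : measurable_fun setT (fun z : R * R * R * R * R * R =>
  F z.1.1.1.1.1 z.1.1.1.1.2 z.1.1.1.2 z.1.1.2 z.1.2 z.2).
Hypothesis F0 : forall eta mu x y t v, (0 <= F eta mu x y t v)%E.

Ltac nng := repeat first [exact: F0 | move=> ? | apply: egint_ge0; [gp|] | apply: sume_ge0].
Ltac mes := repeat first
  [apply: (measurable_comp6 mF); mproj
  |apply: emeasurable_sum => ?
  |apply: measurable_egint; [mgf| |nng] => /=].

Let E := egint a b.
Let E' := egint c d.

(** The one-variable identity is applied in $x,t,\eta$ with the whole $(y,v,\mu)$ block as
    integrand, and then inside that block. Everything else commutes layers, which is possible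
    because the layers in $x,t,\eta$ do not depend on $y,v,\mu$, nor conversely. *)
Lemma egint_Psi_reorder2 i j p s :
  (i < 3)%N -> (j < 3)%N -> (p < 3)%N -> (s < 3)%N ->
  E gunit (fun x => E' gunit (fun y => (\sum_(k < 3) \sum_(r < 3)
    E (part_gfun k x) (fun t => E' (part_gfun r y) (fun v =>
    E (Psi k i j x t) (fun eta => E' (Psi r p s y v) (fun mu =>
    F eta mu x y t v)))))%E)) =
  E gunit (fun eta => E' gunit (fun mu =>
    E (part_gfun (bar i) eta) (fun x => E' (part_gfun (bar p) mu) (fun y =>
    E (part_gfun j eta) (fun t => E' (part_gfun s mu) (fun v =>
    F eta mu x y t v)))))).
Proof.
move=> i3 j3 p3 s3; rewrite /E /E'.
transitivity (egint a b gunit (fun x => (\sum_(k < 3)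
  egint a b (part_gfun k x) (fun t => egint a b (Psi k i j x t) (fun eta =>
  egint c d gunit (fun y => (\sum_(r < 3) egint c d (part_gfun r y) (fun v =>
    egint c d (Psi r p s y v) (fun mu => F eta mu x y t v)))%E))))%E)).
  apply: eq_egint => x.
  transitivity (\sum_(k < 3) \sum_(r < 3) egint c d gunit (fun y =>
    egint a b (part_gfun k x) (fun t => egint c d (part_gfun r y) (fun v =>
    egint a b (Psi k i j x t) (fun eta => egint c d (Psi r p s y v) (fun mu =>
    F eta mu x y t v))))))%E.
    etransitivity.
      apply: egint_sum; [gp| |by nng].
      by move=> k; mes.
    apply: eq_bigr => k _; apply: egint_sum; [gp| |by nng].
    by move=> r; mes.
  apply: eq_bigr => k _.
  transitivity (\sum_(r < 3) egint a b (part_gfun k x) (fun t =>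
    egint a b (Psi k i j x t) (fun eta => egint c d gunit (fun y =>
    egint c d (part_gfun r y) (fun v => egint c d (Psi r p s y v) (fun mu =>
    F eta mu x y t v))))))%E.
    apply: eq_bigr => r _.
    transitivity (egint c d gunit (fun y => egint a b (part_gfun k x) (fun t =>
      egint a b (Psi k i j x t) (fun eta => egint c d (part_gfun r y) (fun v =>
      egint c d (Psi r p s y v) (fun mu => F eta mu x y t v)))))).
      apply: eq_egint => y; apply: eq_egint => t.
      apply: egint_swap; [gp|gp| |by nng].
      by mes.
    etransitivity.
      apply: egint_swap; [gp|gp| |by nng].
      by mes.
    apply: eq_egint => t; apply: egint_swap; [gp|gp| |by nng].
    by mes.
  etransitivity.
    apply/esym; apply: egint_sum; [gp| |by nng].
    by move=> r; mes.
  apply: eq_egint => t; etransitivity.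
    apply/esym; apply: egint_sum; [gp| |by nng].
    by move=> r; mes.
  apply: eq_egint => eta; apply/esym; apply: egint_sum; [gp| |by nng].
  by move=> r; mes.
etransitivity.
  apply: (@egint_Psi_reorder _ _ _ (fun eta x t =>
    egint c d gunit (fun y => (\sum_(r < 3) egint c d (part_gfun r y) (fun v =>
    egint c d (Psi r p s y v) (fun mu => F eta mu x y t v)))%E))) => //.
  - by mes.
  - by nng.
apply: eq_egint => eta.
transitivity (egint a b (part_gfun (bar i) eta) (fun x =>
   egint a b (part_gfun j eta) (fun t => egint c d gunit (fun mu =>
   egint c d (part_gfun (bar p) mu) (fun y => egint c d (part_gfun s mu) (fun v =>
   F eta mu x y t v)))))).
  apply: eq_egint => x; apply: eq_egint => t.
  apply: (@egint_Psi_reorder _ _ _ (fun mu y v => F eta mu x y t v)) => //.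
  by apply: (measurable_comp6 mF); mproj.
transitivity (egint c d gunit (fun mu => egint a b (part_gfun (bar i) eta) (fun x =>
   egint a b (part_gfun j eta) (fun t =>
   egint c d (part_gfun (bar p) mu) (fun y => egint c d (part_gfun s mu) (fun v =>
   F eta mu x y t v)))))).
  etransitivity.
    apply: eq_egint => x; apply: egint_swap; [gp|gp| |by nng].
    by mes.
  apply: egint_swap; [gp|gp| |by nng].
  by mes.
apply: eq_egint => mu; apply: eq_egint => x; apply: egint_swap; [gp|gp| |by nng].
by mes.
Qed.

End order2.

(** * Signed iterated integrals *)

Section RintegralZl_nonmeasurable.
Local Open Scope ereal_scope.
Context d (T : measurableType d) (R : realType) (mu : {measure set T -> \bar R}).
Implicit Types (f : T -> \bar R).
Import HBNNSimple.

(** The integral is unfolded as a supremum over simple functions, and scaling a simple function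
    below [f] gives one below the scaled [f]; this covers nonmeasurable [f]. *)
Lemma integral_scale_le f (c : R) : (0 < c)%R -> (forall x, 0 <= f x) ->
  c%:E * \int[mu]_x f x <= \int[mu]_x (c%:E * f x).
Proof.
move=> c0 f0.
have cf0 x : 0 <= c%:E * f x by rewrite mule_ge0// lee_fin ltW.
suff: \int[mu]_x f x <= (c^-1)%:E * \int[mu]_x (c%:E * f x).
  by rewrite lee_pdivlMl.
rewrite [leLHS]ge0_integralTE//; apply: ge_ereal_sup => _ /= [h hf <-].
rewrite lee_pdivlMl//.
rewrite -sintegralrM (_ : (_ \* _)%R = scale_nnsfun h (ltW c0))//.
rewrite ge0_integralTE//; apply: ereal_sup_ubound; exists (scale_nnsfun h (ltW c0)) => //.
by move=> x /=; rewrite EFinM lee_pmul2l// lte_fin.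
Qed.

Lemma integral_scale f (c : R) : (0 < c)%R -> (forall x, 0 <= f x) ->
  \int[mu]_x (c%:E * f x) = c%:E * \int[mu]_x f x.
Proof.
move=> c0 f0; apply/eqP; rewrite eq_le integral_scale_le// andbT.
rewrite -lee_pdivrMl//; apply: le_trans (integral_scale_le _ _) _.
- by rewrite invr_gt0.
- by move=> x; rewrite mule_ge0// lee_fin ltW.
- rewrite le_eqVlt; apply/orP; left; apply/eqP; apply: eq_integral => x _.
  by rewrite muleA -EFinM mulVf ?mul1e// gt_eqF.
Qed.
End RintegralZl_nonmeasurable.

(** If the positive or the negative part has infinite integral, both sides are 0. This generality
    serves the pointwise identities for [opL] and [opR], which move factors through integrals that
    may diverge. *)
Lemma RintegralZl_gen d (T : measurableType d) (R : realType)
    (mu : {measure set T -> \bar R}) (D : set T) (f : T -> R) (c : R) :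
  \int[mu]_(x in D) (c * f x) = c * \int[mu]_(x in D) f x.
Proof.
have pos (c0 : R) g : 0 < c0 -> \int[mu]_x (c0 * g x) = c0 * \int[mu]_x g x.
  move=> c00; rewrite /Rintegral [in LHS]integralE [in RHS]integralE.
  rewrite (_ : (fun x => (c0 * g x)%:E) = (fun x => c0%:E * (g x)%:E)%E)//.
  rewrite ge0_funeposM ?ge0_funenegM ?ltW// !integral_scale//.
  set p := (\int[mu]_x _)%E; set q := (\int[mu]_x _)%E.
  have p0 : (0 <= p)%E by exact: integral_ge0.
  have q0 : (0 <= q)%E by exact: integral_ge0.
  case: p p0 => [p||]; case: q q0 => [q||] // _ _ /=;
    rewrite ?gt0_muley ?lte_fin//= ?mulr0//.
  by rewrite mulrBr.
have neg g : \int[mu]_x (- g x) = - \int[mu]_x g x.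
  rewrite /Rintegral [in LHS]integralE [in RHS]integralE.
  rewrite (_ : (fun x => (- g x)%:E) = (\- (fun x => (g x)%:E))%E)//.
  rewrite funeposN funenegN.
  set p := (\int[mu]_x _)%E; set q := (\int[mu]_x _)%E.
  have p0 : (0 <= p)%E by exact: integral_ge0.
  have q0 : (0 <= q)%E by exact: integral_ge0.
  by case: p p0 => [p||]; case: q q0 => [q||] // _ _ /=; rewrite ?oppr0// opprB.
rewrite [in LHS]Rintegral_mkcond [in RHS]Rintegral_mkcond.
rewrite (_ : _ \_ D = fun x => c * (f \_ D) x); last first.
  by apply/funext => x; rewrite /patch; case: ifP; rewrite ?mulr0.
case: (ltgtP c 0) => [c0|c0|->].
- rewrite -[c]opprK [RHS]mulNr -pos ?oppr_gt0// -neg.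
  by apply: eq_Rintegral => x _; rewrite mulNr.
- exact: pos.
- rewrite mul0r; under eq_Rintegral do rewrite mul0r.
  by rewrite Rintegral_cst// mul0r.
Qed.

(** * Signed layers as differences of nonnegative ones *)

Section gint.
Context {R : realType}.
Variables al be : R.
Implicit Types (psi : gfun R) (f g : R -> R).
Local Notation leb := (@lebesgue_measure R).

Lemma gint_fine (h : R -> R) f : gint al be (GFun h) f =
  fine (\int[leb]_s (itvw al be s * h s * f s)%:E).
Proof.
rewrite /gint Rintegral_mkcond; congr fine; apply: eq_integral => s _.
rewrite /patch /itvw mem_setE in_itv /=.
by case: ifP => _; rewrite ?mul1r// !mul0r.
Qed.

Lemma gintZl psi f c : gint al be psi (fun s => c * f s) = c * gint al be psi f.
Proof.
case: psi => [//|h] /=; rewrite -RintegralZl_gen; apply: eq_Rintegral => s _.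
by rewrite mulrCA.
Qed.

Lemma gintZr psi f c : gint al be psi (fun s => f s * c) = gint al be psi f * c.
Proof. by rewrite mulrC -gintZl; congr gint; apply/funext => s; rewrite mulrC. Qed.

Lemma eq_gint psi f g :
  (if psi is GDelta p then f p = g p else True) ->
  (forall s, al <= s -> s <= be -> f s = g s) ->
  gint al be psi f = gint al be psi g.
Proof.
case: psi => [p //|h] _ fg; rewrite /gint; apply: eq_Rintegral => s.
by rewrite mem_setE in_itv /= => /andP[? ?]; rewrite fg.
Qed.

(* [f] is an absolutely convergent integral whose positive and negative parts
   integrate to [p] and [n]; nothing but the bound is claimed if one of these
   is infinite. *)
Definition repr_diff (f : R) (p n : \bar R) :=
  (`|f|%:E <= p + n)%E /\ ((p < +oo)%E -> (n < +oo)%E -> f%:E = (p - n)%E).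

(** [p] and [n] may exceed the positive and negative parts of [f]: in the applications they
    integrate the parts of an innermost integrand, before any cancellation. *)
Definition Repr d (X : measurableType d) (f : X -> R) (p n : X -> \bar R) :=
  [/\ measurable_fun setT f, measurable_fun setT p, measurable_fun setT n &
    forall x, [/\ (0 <= p x)%E, (0 <= n x)%E & repr_diff (f x) (p x) (n x)]].

End gint.

(** If both integrals are finite, [p] and [n] are finite almost everywhere, so [f = p - n] almost
    everywhere: the points at which [repr_diff] gives no equality form a null set. *)
Lemma repr_diff_Rintegral d (T : measurableType d) (R : realType)
    (mu : {measure set T -> \bar R}) (f : T -> R) (p n : T -> \bar R) :
  Repr f p n ->
  repr_diff (\int[mu]_x f x) (\int[mu]_x p x)%E (\int[mu]_x n x)%E.
Proof.
move=> [mf mp mn H].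
have p0 x : (0 <= p x)%E by case: (H x).
have n0 x : (0 <= n x)%E by case: (H x).
have mEf : measurable_fun setT (EFin \o f) by exact/measurable_EFinP.
split.
  (* [fine] replaces an infinite value by 0, which only decreases the absolute value. *)
  apply: (@le_trans _ _ (`|\int[mu]_x (f x)%:E|)%E).
    rewrite /Rintegral; case: (\int[mu]_x _)%E => [r| |] //=.
    by rewrite normr0 leey.
    by rewrite normr0 leey.
  apply: (le_trans (le_abse_integral mu measurableT mEf)).
  rewrite -ge0_integralD//; apply: ge0_le_integral => //.
  - exact: measurableT_comp.
  - exact: emeasurable_funD.
  - by move=> x _; case: (H x) => _ _ [].
move=> poo noo.
have ip : mu.-integrable setT p.
  by apply/integrableP; split => //; under eq_integral do rewrite gee0_abs//.
have iN : mu.-integrable setT n.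
  by apply/integrableP; split => //; under eq_integral do rewrite gee0_abs//.
have E : (\int[mu]_x (f x)%:E = \int[mu]_x (p x - n x))%E.
  apply: ae_eq_integral => //.
  - exact: emeasurable_funB.
  - have := integrable_ae measurableT ip; have := integrable_ae measurableT iN.
    apply: filterS2 => x nx px _; case: (H x) => _ _ [_]; apply.
    + by rewrite ltey_eq px.
    + by rewrite ltey_eq nx.
have E2 : (\int[mu]_x (p x - n x) = \int[mu]_x p x - \int[mu]_x n x)%E.
  exact: integralB.
rewrite /Rintegral E E2 fineK// fin_numB; apply/andP; split.
- by rewrite ge0_fin_numE// integral_ge0.
- by rewrite ge0_fin_numE// integral_ge0.
Qed.

Section Repr.
Context {R : realType}.
Local Notation leb := (@lebesgue_measure R).

Lemma Repr_base d (X : measurableType d) (f : X -> R) :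
  measurable_fun setT f ->
  Repr f (fun x => (Num.max (f x) 0)%:E) (fun x => (Num.max (- f x) 0)%:E).
Proof.
move=> mf; split => //.
- apply/measurable_EFinP; exact: measurable_maxr.
- apply/measurable_EFinP; apply: measurable_maxr => //; exact: measurable_funN.
move=> x; split; first by rewrite lee_fin le_max lexx orbT.
  by rewrite lee_fin le_max lexx orbT.
case: (boolP (0 <= f x)) => [fx0|]; last rewrite -ltNge => fx0.
  rewrite (max_l fx0) max_r ?oppr_le0//; split; first by rewrite ger0_norm// adde0.
  by rewrite sube0.
rewrite (max_r (ltW fx0)) max_l ?oppr_ge0 ?ltW//; split.
  by rewrite ltr0_norm// add0e.
by rewrite sub0e EFinN oppeK.
Qed.

Lemma repr_diff_sum (I : finType) (f : I -> R) (p n : I -> \bar R) :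
  (forall i, 0 <= p i)%E -> (forall i, 0 <= n i)%E ->
  (forall i, repr_diff (f i) (p i) (n i)) ->
  repr_diff (\sum_i f i) (\sum_i p i)%E (\sum_i n i)%E.
Proof.
move=> p0 n0 H; split.
  rewrite -big_split /=; apply: (@le_trans _ _ (\sum_i `|f i|)%:E).
    by rewrite lee_fin ler_norm_sum.
  by rewrite -sumEFin; apply: lee_sum => i _; case: (H i).
move=> poo noo.
have pf i : (p i < +oo)%E.
  by apply: le_lt_trans poo; rewrite (bigD1 i)//= leeDl// sume_ge0.
have nf i : (n i < +oo)%E.
  by apply: le_lt_trans noo; rewrite (bigD1 i)//= leeDl// sume_ge0.
rewrite -sumEFin.
rewrite -fin_num_sumeN; last by move=> i _; rewrite ge0_fin_numE.
rewrite -big_split /=.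
by apply: eq_bigr => i _; case: (H i) => _; apply.
Qed.

Lemma Repr_sum d (X : measurableType d) (I : finType) (f : I -> X -> R)
    (p n : I -> X -> \bar R) : (forall i, Repr (f i) (p i) (n i)) ->
  Repr (fun x => \sum_i f i x) (fun x => \sum_i p i x)%E (fun x => \sum_i n i x)%E.
Proof.
move=> H; split.
- by apply: measurable_sum => i; case: (H i).
- by apply: emeasurable_sum => i; case: (H i).
- by apply: emeasurable_sum => i; case: (H i).
move=> x.
have K i := let: And4 _ _ _ k := H i in k x.
split.
- by apply: sume_ge0 => i _; case: (K i).
- by apply: sume_ge0 => i _; case: (K i).
- by apply: repr_diff_sum => i; case: (K i).
Qed.

Lemma repr_diff_scale (c f : R) (p n : \bar R) : 0 <= c ->
  (0 <= p)%E -> (0 <= n)%E -> repr_diff f p n ->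
  repr_diff (c * f) (c%:E * p)%E (c%:E * n)%E.
Proof.
rewrite le_eqVlt => /predU1P[<-|c0] p0 n0 [H1 H2].
  (* For [c = 0] the scaled [p] and [n] are 0 even if [p] or [n] is infinite, so the equality cannot
     come from [H2]; it reads 0 = 0. *)
  by rewrite mul0r !mul0e; split; rewrite ?normr0 ?adde0 ?sube0.
split.
  by rewrite normrM (gtr0_norm c0) EFinM -ge0_muleDr// lee_pmul2l// lte_fin.
case: p n p0 n0 H1 H2 => [p||] [n||] // _ _ _ H2; rewrite ?gt0_muley ?lte_fin//.
by move=> _ _; have [->] := H2 (ltry _) (ltry _); rewrite -!EFinM -EFinB mulrBr.
Qed.

Lemma Repr_gint d (X : measurableType d) al be (psi : X -> gfun R)
    (f : X -> R -> R) (p n : X -> R -> \bar R) : mgfun psi ->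
  Repr (fun z : X * R => f z.1 z.2) (fun z => p z.1 z.2) (fun z => n z.1 z.2) ->
  Repr (fun x => gint al be (psi x) (f x)) (fun x => egint al be (psi x) (p x))
       (fun x => egint al be (psi x) (n x)).
Proof.
move=> mpsi [mf mp mn H].
have p0 x s : (0 <= p x s)%E by case: (H (x, s)).
have n0 x s : (0 <= n x s)%E by case: (H (x, s)).
split.
- case: mpsi => [[q mq E]|[h [mh h0 E]]].
    rewrite (_ : (fun x => _) = (fun x => f x (q x))); last first.
      by apply/funext => x; rewrite E.
    by apply: (measurable_comp2 mf).
  rewrite (_ : (fun x => _) = (fun x => fine (\int[leb]_s
     (itvw al be s * h x s * f x s)%:E))); last first.
    by apply/funext => x; rewrite E; exact: gint_fine.
  apply: measurableT_comp => //.
  pose G (z : X * R) := (itvw al be z.2 * h z.1 z.2 * f z.1 z.2)%:E.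
  have mG : measurable_fun setT G.
    apply/measurable_EFinP; apply: measurable_funM => //.
    apply: measurable_funM => //.
    by apply: (measurableT_comp (measurable_itvw al be)); mproj.
  (* A signed integral is measurable in its parameter as a difference of two Tonelli integrals. *)
  rewrite (_ : (fun x => _) = (fun x => fubini_F leb G^\+ x - fubini_F leb G^\- x)%E).
    apply: emeasurable_funB; apply: measurable_fun_fubini_tonelli_F => //.
    + exact: measurable_funepos.
    + exact: measurable_funeneg.
  by apply/funext => x; rewrite integralE /fubini_F; congr (_ - _)%E;
    apply: eq_integral => s _; rewrite ?funeposE ?funenegE.
- exact: measurable_egint.
- exact: measurable_egint.
move=> x; have gp := mgfun_gpos x mpsi; split.
- exact: egint_ge0.
- exact: egint_ge0.
case: (psi x) gp => [q _|h [mh h0]].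
  by case: (H (x, q)).
rewrite gint_fine; apply: (@repr_diff_Rintegral _ _ _ leb); split.
- apply: measurable_funM; last by apply: (measurable_comp2 mf); mproj.
  by apply: measurable_funM => //; exact: measurable_itvw.
- by apply: measurable_wgt; [exact: mh|apply: (measurable_comp2 mp); mproj|mproj].
- by apply: measurable_wgt; [exact: mh|apply: (measurable_comp2 mn); mproj|mproj].
move=> s; split; [exact: wgt_ge0|exact: wgt_ge0|].
by apply: repr_diff_scale => //; [rewrite mulr_ge0// itvw_ge0|case: (H (x, s))].
Qed.

End Repr.

(** * Square integrability by resonance *)

Lemma L2_onP d (T : measurableType d) (R : realType)
    (mu : {measure set T -> \bar R}) (D : set T) (f : T -> R) :
  L2_on mu D f <-> measurable_fun setT (f \_ D) /\
    (\int[mu]_x (((f \_ D) x) ^+ 2)%:E < +oo)%E.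
Proof.
have E x : ((`|((f \_ D) x)%:E| `^ 2) = (((f \_ D) x) ^+ 2)%:E)%E.
  by rewrite /= powR_mulrn// real_normK// num_real.
split => [L|[mf fi]].
  split; first by move: L; rewrite /L2_on inE => /andP[]; rewrite inE.
  have /integrableP[_] := Lfun2_integrable_sqr L.
  apply: le_lt_trans; apply: ge0_le_integral => //.
  - by move=> x _; rewrite lee_fin sqr_ge0.
  - apply/measurable_EFinP; apply: measurable_funX.
    by move: L; rewrite /L2_on inE => /andP[]; rewrite inE.
  - apply: measurableT_comp => //; apply/measurable_EFinP; apply: measurable_funX.
    by move: L; rewrite /L2_on inE => /andP[]; rewrite inE.
  - by move=> x _; exact: lee_abs.
rewrite /L2_on inE; apply/andP; split; first by rewrite inE.
rewrite inE /= /finite_norm unlock; apply: poweR_lty.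
rewrite (_ : (\int[mu]_x _ = \int[mu]_x ((f \_ D) x ^+ 2)%:E)%E)//.
by apply: eq_integral => x _; exact: E.
Qed.

Section resonance.
Context d (T : measurableType d) (R : realType) (mu : {measure set T -> \bar R}).
Local Open Scope ereal_scope.

Variables (D : set T) (g : T -> R).
Hypotheses (mD : measurable D) (Doo : mu D < +oo).
Hypotheses (mg : measurable_fun setT g) (g0 : forall x, (0 <= g x)%R).
Hypothesis gD : forall x, ~ D x -> g x = 0%R.

Let h (n : nat) (x : T) : R := Num.min (g x) n%:R.

Let mh n : measurable_fun setT (h n).
Proof. by apply: measurable_minr => //; exact: measurable_cst. Qed.

Let h_ge0 n x : (0 <= h n x)%R.
Proof. by rewrite /h le_min g0 ler0n. Qed.

Let h_le n x : (h n x <= g x)%R.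
Proof. by rewrite /h ge_min lexx. Qed.

Let m_sqr (f : T -> R) : measurable_fun setT f ->
  measurable_fun setT (fun x => (f x ^+ 2)%:E).
Proof. by move=> mf; apply/measurable_EFinP; exact: measurable_funX. Qed.

(** A truncation is bounded and vanishes off the set [D] of finite measure. This makes the numbers
    $r_k$ of the construction below finite. *)
Let int_h_fin n : \int[mu]_x (h n x ^+ 2)%:E < +oo.
Proof.
apply: (@le_lt_trans _ _ (\int[mu]_(x in D) (n%:R ^+ 2)%:E)).
  rewrite [leRHS]integral_mkcond; apply: ge0_le_integral => //.
  - by move=> x _; rewrite lee_fin sqr_ge0.
  - exact: m_sqr.
  - by apply/(measurable_restrictT _ mD).1; exact: measurable_cst.
  - move=> x _; rewrite patchE; case: ifPn => [_|].
      rewrite lee_fin ler_sqr ?nnegrE// ?ler0n//.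
      by rewrite /h ge_min lexx orbT.
    rewrite notin_setE => /gD gx0.
    by rewrite /h gx0 (_ : Num.min _ _ = 0%R) ?expr0n// min_l.
rewrite integral_cst// lte_mul_pinfty// lee_fin sqr_ge0//.
Qed.

Let int_h_large : \int[mu]_x (g x ^+ 2)%:E = +oo ->
  forall M : R, exists n, M%:E <= \int[mu]_x (h n x ^+ 2)%:E.
Proof.
move=> goo M.
have := @cvg_monotone_convergence _ T R mu setT measurableT
  (fun n x => (h n x ^+ 2)%:E) (fun n => m_sqr (mh n)).
(* At each point the truncations are constant as soon as [n] exceeds [g x]. *)
have hl x : limn (fun n => (h n x ^+ 2)%:E) = (g x ^+ 2)%:E.
  apply: lim_near_cst => //.
  have [N gN] : exists N : nat, (g x <= N%:R)%R.
    by exists (Num.bound (g x)); apply/ltW; exact: archi_boundP.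
  exists N => // n /= Nn; rewrite /h min_l//.
  by rewrite (le_trans gN)// ler_nat.
under [X in _ --> X]eq_integral do rewrite hl.
rewrite goo => /(_ _ _)/cvgeyPger H.
have [//|||N _ HN] := H _ _ M.
- by move=> n x _; rewrite lee_fin sqr_ge0.
- move=> x _ m n mn; rewrite lee_fin ler_sqr ?nnegrE//.
  rewrite /h le_min ge_min lexx /= ge_min; apply/orP; right.
  by rewrite ler_nat.
- exact: num_real.
by exists N; exact: HN N (leqnn _).
Qed.

(* If [g] is not square integrable, choose truncations [h_k] of [g] with
   [r_k := int h_k^2 >= 2^(k+1) (k+1)^2]. Then [w^2 := sum_k h_k^2 / (2^(k+1) r_k)]
   has integral 1, while [int g w >= sqrt (r_k / 2^(k+1)) >= k + 1] for all [k]. *)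
Lemma L2_resonance :
  (forall w : T -> R, measurable_fun setT w -> (forall x, (0 <= w x)%R) ->
     \int[mu]_x (w x ^+ 2)%:E < +oo -> \int[mu]_x (g x * w x)%:E < +oo) ->
  \int[mu]_x (g x ^+ 2)%:E < +oo.
Proof.
move=> H; rewrite ltNge leye_eq; apply/negP => /eqP goo.
pose c (k : nat) : R := (2 ^ k.+1)%:R.
have c0 k : (0 < c k)%R by rewrite ltr0n expn_gt0.
pose M k := (c k * k.+1%:R ^+ 2)%R.
have M0 k : (0 < M k)%R by rewrite mulr_gt0// exprn_gt0// ltr0n.
have [N NM] := choice (fun k => int_h_large goo (M k)).
pose r k := fine (\int[mu]_x (h (N k) x ^+ 2)%:E).
have rE k : (r k)%:E = \int[mu]_x (h (N k) x ^+ 2)%:E.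
  rewrite fineK// ge0_fin_numE//.
  by apply: integral_ge0 => x _; rewrite lee_fin sqr_ge0.
have Mr k : (M k <= r k)%R by rewrite -lee_fin rE.
have r0 k : (0 < r k)%R by rewrite (lt_le_trans (M0 k)).
have M1 k : (1 <= M k)%R.
  by rewrite mulr_ege1 ?ler1n ?expn_gt0// -natrX ler1n expn_gt0.
pose a k x := (h (N k) x ^+ 2 / (c k * r k))%R.
have a0 k x : (0 <= a k x)%R by rewrite divr_ge0 ?sqr_ge0// mulr_ge0// ltW.
pose W x := \sum_(k <oo) (a k x)%:E.
have half (s : R) : (\sum_(k <oo) (s / c k)%:E = s%:E).
  have := @cvg_geometric_eseries_half R s 0; rewrite expr0 divr1 => /cvg_lim <-//.
  by apply: congr_lim; apply/funext => n; apply: eq_bigr => k _; rewrite addn1.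
(* Since $r_k\ge 1$ and $h_k\le g$, the series is dominated by $\sum_k g^2/2^{k+1}=g^2$; thus [W] is
   finite everywhere and [w] can be real-valued. *)
have Wg x : W x <= (g x ^+ 2)%:E.
  rewrite -(half (g x ^+ 2)%R); apply: lee_nneseries => [k _ _|k _].
    by rewrite lee_fin.
  rewrite lee_fin /a; apply: ler_pM.
  - exact: sqr_ge0.
  - by rewrite invr_ge0 mulr_ge0// ltW.
  - by rewrite ler_sqr ?nnegrE.
  - rewrite lef_pV2 ?posrE ?mulr_gt0//.
    by rewrite ler_peMr ?(ltW (c0 k))// (le_trans (M1 k)).
have W0 x : 0 <= W x by apply: nneseries_ge0 => k _ _; rewrite lee_fin.
have Wfin x : W x \is a fin_num.
  by rewrite ge0_fin_numE// (le_lt_trans (Wg x))// ltry.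
have ma k : measurable_fun setT (fun x => (a k x)%:E).
  apply/measurable_EFinP; apply: measurable_funM; last exact: measurable_cst.
  exact: measurable_funX.
have mW : measurable_fun setT W.
  by apply: ge0_emeasurable_sum => // k x _ _; rewrite lee_fin.
pose w x := Num.sqrt (fine (W x)).
have mw : measurable_fun setT w.
  apply: (measurableT_comp (f := @Num.sqrt R)); last exact: measurableT_comp.
  apply: continuous_measurable_fun; exact: sqrt_continuous.
have w2 x : ((w x ^+ 2)%:E = W x).
  by rewrite /w sqr_sqrtr ?fine_ge0// fineK.
have inta k : \int[mu]_x (a k x)%:E = (1 / c k)%:E.
  rewrite /a; under eq_integral do rewrite mulrC EFinM.
  rewrite ge0_integralZl_EFin//.
  - by rewrite -rE -EFinM invfM -mulrA mulVf ?gt_eqF// mulr1 div1r.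
  - by move=> x _; rewrite lee_fin sqr_ge0.
  - exact: m_sqr.
  - by rewrite invr_ge0 ltW// mulr_gt0.
have intw : \int[mu]_x (w x ^+ 2)%:E = 1.
  under eq_integral do rewrite w2.
  rewrite integral_nneseries//; last by move=> k x _; rewrite lee_fin.
  by under eq_eseriesr do rewrite inta; rewrite half.
have := H w mw (fun x => sqrtr_ge0 _); rewrite intw ltry => /(_ isT).
apply/negP; rewrite -leNgt leye_eq; apply/eqP/eq_infty => t.
have gw k : (k.+1%:R)%:E <= \int[mu]_x (g x * w x)%:E.
  have cr0 : (0 <= c k * r k)%R by exact/ltW/mulr_gt0.
  pose s := (Num.sqrt (c k * r k))^-1%R.
  have s0 : (0 < s)%R by rewrite invr_gt0 sqrtr_gt0 mulr_gt0.
  apply: (@le_trans _ _ (s * r k)%:E).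
    rewrite lee_fin /s mulrC ler_pdivlMr ?sqrtr_gt0 ?mulr_gt0//.
    rewrite -ler_sqr ?nnegrE ?mulr_ge0 ?sqrtr_ge0 ?ler0n ?(ltW (r0 k))//.
    rewrite exprMn sqr_sqrtr//.
    by rewrite mulrA [leRHS]expr2 ler_pM2r// mulrC; exact: Mr.
  rewrite EFinM rE -ge0_integralZl_EFin//; last 3 first.
  - by move=> x _; rewrite lee_fin sqr_ge0.
  - exact: m_sqr.
  - exact: ltW.
  apply: ge0_le_integral => //.
  - by move=> x _; rewrite mule_ge0// lee_fin ?sqr_ge0// ltW.
  - by apply: measurable_funeM; exact: m_sqr.
  - by apply/measurable_EFinP; exact: measurable_funM.
  move=> x _; rewrite -EFinM lee_fin expr2 mulrCA ler_pM ?mulr_ge0 ?(ltW s0)//.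
  (* Only the $k$-th term of the series is kept: $w^2\ge h_k^2/(2^{k+1}r_k)$. *)
  rewrite /w -[leLHS]ger0_norm ?mulr_ge0 ?(ltW s0)// -sqrtr_sqr ler_wsqrtr//.
  rewrite exprMn /s exprVn sqr_sqrtr// mulrC -lee_fin fineK//.
  apply: le_trans (nneseries_lim_ge k.+1 _); last by move=> *; rewrite lee_fin.
  rewrite big_nat_recr //= leeDr// sume_ge0// => i _; by rewrite lee_fin.
apply: le_trans (gw (Num.bound `|t|)); rewrite lee_fin.
apply: (le_trans (ler_norm t)); apply/ltW.
apply: (lt_trans (archi_boundP (normr_ge0 t))).
by rewrite ltr_nat.
Qed.

End resonance.

(** * The quadruple integral in two orders *)

Section rect_integral.
Context {R : realType}.
Variables a b c d : R.
Local Notation leb2 := (@leb2 R).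
Local Notation rect := (rect a b c d).

Lemma mem_rect (x y : R) :
  ((x, y) \in rect) = ((a <= x) && (x <= b)) && ((c <= y) && (y <= d)).
Proof.
apply/idP/idP; rewrite inE /rect /=.
  by case=> /=; rewrite !in_itv /= => -> ->.
by move=> /andP[? ?]; split; rewrite /= in_itv.
Qed.

Lemma measurable_rect : measurable rect.
Proof. by apply: measurableX; exact: measurable_itv. Qed.

Definition rectw (z : R * R) : R := itvw a b z.1 * itvw c d z.2.

Lemma measurable_rectw : measurable_fun setT rectw.
Proof.
apply: measurable_funM.
- by apply: (measurableT_comp (measurable_itvw a b)); mproj.
- by apply: (measurableT_comp (measurable_itvw c d)); mproj.
Qed.

Lemma rectw_ge0 z : 0 <= rectw z.
Proof. by rewrite mulr_ge0// itvw_ge0. Qed.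

Lemma patch_rectw (f : R * R -> R) : f \_ rect = fun z => rectw z * f z.
Proof.
apply/funext => -[x y]; rewrite patchE mem_rect /rectw /itvw /=.
by case: (_ <= x <= _); case: (_ <= y <= _); rewrite /= ?(mul1r, mul0r, mulr0).
Qed.

Lemma epatch_rectw (f : R * R -> \bar R) :
  f \_ rect = fun z => ((rectw z)%:E * f z)%E.
Proof.
apply/funext => -[x y]; rewrite patchE mem_rect /rectw /itvw /=.
by case: (_ <= x <= _); case: (_ <= y <= _); rewrite /= ?(mul1r, mul0r, mulr0, mul1e, mul0e).
Qed.

Lemma integral_rect (p : R -> R -> \bar R) :
  measurable_fun setT (fun z : R * R => p z.1 z.2) ->
  (forall x y, 0 <= p x y)%E ->
  (\int[leb2]_(z in rect) p z.1 z.2)%E =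
  egint a b gunit (fun x => egint c d gunit (fun y => p x y)).
Proof.
move=> mp p0; rewrite integral_mkcond epatch_rectw.
have mw : measurable_fun setT (fun z : R * R => ((rectw z)%:E * p z.1 z.2)%E).
  apply: emeasurable_funM => //.
  by apply/measurable_EFinP; exact: measurable_rectw.
etransitivity.
  apply: (@fubini_tonelli1 _ _ _ _ R lebesgue_measure lebesgue_measure _ mw).
  by move=> z; rewrite mule_ge0// lee_fin rectw_ge0.
apply: eq_integral => x _; rewrite /fubini_F /=.
rewrite -ge0_integralZl//.
- apply: eq_integral => y _; rewrite /rectw /= !mulr1 EFinM.
  by rewrite muleA.
- by apply: measurable_wgt; [mproj|apply: (measurable_comp2 mp); mproj|mproj].
- by move=> y _; apply: wgt_ge0.
- by rewrite lee_fin mulr1 itvw_ge0.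
Qed.

Lemma repr_diff_rect (f : R * R -> R) (p n : R * R -> \bar R) : Repr f p n ->
  repr_diff (\int[leb2]_(z in rect) f z)
    (\int[leb2]_(z in rect) p z)%E (\int[leb2]_(z in rect) n z)%E.
Proof.
move=> [mf mp mn H].
have Ef : \int[leb2]_(z in rect) f z = \int[leb2]_z (rectw z * f z).
  by rewrite Rintegral_mkcond patch_rectw.
have Ee (q : R * R -> \bar R) :
    (\int[leb2]_(z in rect) q z = \int[leb2]_z ((rectw z)%:E * q z))%E.
  by rewrite integral_mkcond epatch_rectw.
rewrite Ef !Ee; apply: repr_diff_Rintegral; split.
- by apply: measurable_funM => //; exact: measurable_rectw.
- by apply: emeasurable_funM => //; apply/measurable_EFinP; exact: measurable_rectw.
- by apply: emeasurable_funM => //; apply/measurable_EFinP; exact: measurable_rectw.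
move=> z; have [p0 n0 Hz] := H z.
split; try by rewrite mule_ge0// lee_fin rectw_ge0.
by apply: repr_diff_scale => //; exact: rectw_ge0.
Qed.

End rect_integral.

Section abstract_adjoint.
Context {R : realType}.
Variables a b c d : R.
Variables I1 I2 I3 : finType.
Variables (i j p s : I2 -> nat).
Hypotheses (i3 : forall k, (i k < 3)%N) (j3 : forall k, (j k < 3)%N)
  (p3 : forall k, (p k < 3)%N) (s3 : forall k, (s k < 3)%N).
Local Arguments egint : simpl never.
Local Arguments gint : simpl never.

(* [be] carries the exponents (i, j, p, s) of a term, in addition to a summation
   index; [opL] is the order of integration of [PI_op (LPI Z g P)] and [opR] the
   order of the bilinear form. *)
Definition opL (F : I1 -> I2 -> I3 -> R -> R -> R -> R -> R -> R -> R) (x y : R) : R :=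
  \sum_al \sum_(k < 3) \sum_(r < 3)
    gint a b (part_gfun k x) (fun t => gint c d (part_gfun r y) (fun v =>
    \sum_be gint a b (Psi k (i be) (j be) x t) (fun eta =>
      gint c d (Psi r (p be) (s be) y v) (fun mu =>
      \sum_ga F al be ga eta mu x y t v)))).

Definition opR (F : I1 -> I2 -> I3 -> R -> R -> R -> R -> R -> R -> R) (eta mu : R) : R :=
  \sum_al \sum_be \sum_ga
    gint a b (part_gfun (bar (i be)) eta) (fun x =>
    gint c d (part_gfun (bar (p be)) mu) (fun y =>
    gint a b (part_gfun (j be) eta) (fun t => gint c d (part_gfun (s be) mu) (fun v =>
      F al be ga eta mu x y t v)))).

Definition eopL (F : I1 -> I2 -> I3 -> R -> R -> R -> R -> R -> R -> \bar R) (x y : R) : \bar R :=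
  (\sum_al \sum_(k < 3) \sum_(r < 3)
    egint a b (part_gfun k x) (fun t => egint c d (part_gfun r y) (fun v =>
    \sum_be egint a b (Psi k (i be) (j be) x t) (fun eta =>
      egint c d (Psi r (p be) (s be) y v) (fun mu =>
      \sum_ga F al be ga eta mu x y t v)))))%E.

(** Only [be] affects the layers, while [al] and [ga] merely select the integrand; each triple of
    indices thus gives one iterated integral. *)
Definition eopR1 (be : I2) (F : R -> R -> R -> R -> R -> R -> \bar R) (eta mu : R) : \bar R :=
    egint a b (part_gfun (bar (i be)) eta) (fun x =>
    egint c d (part_gfun (bar (p be)) mu) (fun y =>
    egint a b (part_gfun (j be) eta) (fun t => egint c d (part_gfun (s be) mu) (fun v =>
      F eta mu x y t v)))).

Definition eopR (F : I1 -> I2 -> I3 -> R -> R -> R -> R -> R -> R -> \bar R) (eta mu : R) : \bar R :=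
  (\sum_al \sum_be \sum_ga eopR1 be (F al be ga) eta mu)%E.

Definition measurable6 d' (T : measurableType d') (F : R -> R -> R -> R -> R -> R -> T) :=
  measurable_fun setT (fun z : R * R * R * R * R * R =>
    F z.1.1.1.1.1 z.1.1.1.1.2 z.1.1.1.2 z.1.1.2 z.1.2 z.2).

Lemma egint2_sum (I : finType) (G : I -> R -> R -> \bar R) :
  (forall k, measurable_fun setT (fun z : R * R => G k z.1 z.2)) ->
  (forall k x y, 0 <= G k x y)%E ->
  egint a b gunit (fun eta => egint c d gunit (fun mu => (\sum_k G k eta mu)%E)) =
  (\sum_k egint a b gunit (fun eta => egint c d gunit (fun mu => G k eta mu)))%E.
Proof.
move=> mG G0; transitivity (egint a b gunit (fun eta =>
    (\sum_k egint c d gunit (fun mu => G k eta mu))%E)).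
  apply: eq_egint => eta; apply: egint_sum; [gp| |by []].
  by move=> k; apply: (measurable_comp2 (mG k)); mproj.
apply: egint_sum; [gp| |].
- by move=> k; apply: measurable_egint; [mgf|exact: mG|exact: G0].
- by move=> k eta; apply: egint_ge0; [gp|exact: G0].
Qed.

Section nonneg.
Variable F : I1 -> I2 -> I3 -> R -> R -> R -> R -> R -> R -> \bar R.
Hypothesis mF : forall al be ga, measurable6 (F al be ga).
Hypothesis F0 : forall al be ga eta mu x y t v, (0 <= F al be ga eta mu x y t v)%E.

Ltac nng := repeat first [exact: F0 | move=> ? | apply: egint_ge0; [gp|] | apply: sume_ge0].
Ltac mes := repeat first
  [apply: (measurable_comp6 (mF _ _ _)); mproj
  |apply: emeasurable_sum => ?
  |apply: measurable_egint; [mgf| |nng] => /=].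

Lemma measurable_eopL : measurable_fun setT (fun z : R * R => eopL F z.1 z.2).
Proof. by rewrite /eopL; mes. Qed.

Lemma eopL_ge0 x y : (0 <= eopL F x y)%E.
Proof. by rewrite /eopL; nng. Qed.

Lemma measurable_eopR1 al be ga :
  measurable_fun setT (fun z : R * R => eopR1 be (F al be ga) z.1 z.2).
Proof. by rewrite /eopR1; mes. Qed.

Lemma measurable_eopR : measurable_fun setT (fun z : R * R => eopR F z.1 z.2).
Proof. by do 3 apply: emeasurable_sum => ?; exact: measurable_eopR1. Qed.

Lemma eopR1_ge0 al be ga eta mu : (0 <= eopR1 be (F al be ga) eta mu)%E.
Proof. by rewrite /eopR1; nng. Qed.

Lemma integral_eopR :
  egint a b gunit (fun eta => egint c d gunit (fun mu => eopR F eta mu)) =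
  (\sum_al \sum_be \sum_ga
   egint a b gunit (fun eta => egint c d gunit (fun mu => eopR1 be (F al be ga) eta mu)))%E.
Proof.
rewrite /eopR egint2_sum; last 2 first.
- by move=> al; do 2 apply: emeasurable_sum => ?; exact: measurable_eopR1.
- by move=> al x y; do 2 apply: sume_ge0 => ? _; exact: eopR1_ge0.
apply: eq_bigr => al _; rewrite egint2_sum; last 2 first.
- by move=> be; apply: emeasurable_sum => ?; exact: measurable_eopR1.
- by move=> be x y; apply: sume_ge0 => ? _; exact: eopR1_ge0.
apply: eq_bigr => be _; rewrite egint2_sum //.
- by move=> ga; exact: measurable_eopR1.
- by move=> ga x y; exact: eopR1_ge0.
Qed.

(** In [eopL] the sums over [be] and [ga] sit inside the integrals; nonnegativity lets them out. For
    fixed [be] the exponents are fixed, and the sum over the nine pairs $(k,r)$ is the one that the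
    reordering identity collapses. *)
Lemma integral_eopL :
  egint a b gunit (fun x => egint c d gunit (fun y => eopL F x y)) =
  (\sum_al \sum_be \sum_ga
   egint a b gunit (fun eta => egint c d gunit (fun mu => eopR1 be (F al be ga) eta mu)))%E.
Proof.
transitivity (egint a b gunit (fun x => egint c d gunit (fun y =>
  (\sum_al \sum_be \sum_ga \sum_(k < 3) \sum_(r < 3)
    egint a b (part_gfun k x) (fun t => egint c d (part_gfun r y) (fun v =>
    egint a b (Psi k (i be) (j be) x t) (fun eta =>
      egint c d (Psi r (p be) (s be) y v) (fun mu =>
      F al be ga eta mu x y t v)))))%E))).
  apply: eq_egint => x; apply: eq_egint => y.
  apply: eq_bigr => al _.
  transitivity (\sum_(k < 3) \sum_(r < 3) \sum_be \sum_ga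
    egint a b (part_gfun k x) (fun t => egint c d (part_gfun r y) (fun v =>
    egint a b (Psi k (i be) (j be) x t) (fun eta =>
      egint c d (Psi r (p be) (s be) y v) (fun mu =>
      F al be ga eta mu x y t v)))))%E.
    apply: eq_bigr => k _; apply: eq_bigr => r _.
    transitivity (egint a b (part_gfun k x) (fun t => (\sum_be \sum_ga
      egint c d (part_gfun r y) (fun v =>
      egint a b (Psi k (i be) (j be) x t) (fun eta =>
      egint c d (Psi r (p be) (s be) y v) (fun mu =>
      F al be ga eta mu x y t v))))%E)).
      apply: eq_egint => t.
      transitivity (egint c d (part_gfun r y) (fun v => (\sum_be \sum_ga
        egint a b (Psi k (i be) (j be) x t) (fun eta =>
        egint c d (Psi r (p be) (s be) y v) (fun mu =>
        F al be ga eta mu x y t v)))%E)).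
        apply: eq_egint => v; apply: eq_bigr => be _.
        transitivity (egint a b (Psi k (i be) (j be) x t) (fun eta => (\sum_ga
          egint c d (Psi r (p be) (s be) y v) (fun mu =>
          F al be ga eta mu x y t v))%E)).
          apply: eq_egint => eta; apply: egint_sum; [gp|by move=> ga; mes|by nng].
        apply: egint_sum; [gp|by move=> ga; mes|by nng].
      etransitivity.
        apply: egint_sum; [gp|by move=> be; mes|by nng].
      apply: eq_bigr => be _; apply: egint_sum; [gp|by move=> ga; mes|by nng].
    etransitivity.
      apply: egint_sum; [gp|by move=> be; mes|by nng].
    apply: eq_bigr => be _; apply: egint_sum; [gp|by move=> ga; mes|by nng].
  (* The reordering identity needs the sums over $k$ and $r$ innermost. *)
  under eq_bigr => k _ do rewrite exchange_big.
  rewrite exchange_big; apply: eq_bigr => be _.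
  under eq_bigr => k _ do rewrite exchange_big.
  by rewrite exchange_big.
etransitivity; first by apply: egint2_sum; [move=> ?; mes|nng].
apply: eq_bigr => al _; etransitivity; first by apply: egint2_sum; [move=> ?; mes|nng].
apply: eq_bigr => be _; etransitivity; first by apply: egint2_sum; [move=> ?; mes|nng].
apply: eq_bigr => ga _.
by apply: (egint_Psi_reorder2 a b c d (mF al be ga) (F0 al be ga)).
Qed.

End nonneg.

Definition fpos6 (F : R -> R -> R -> R -> R -> R -> R) eta mu x y t v : \bar R :=
  (Num.max (F eta mu x y t v) 0)%:E.
Definition fneg6 (F : R -> R -> R -> R -> R -> R -> R) eta mu x y t v : \bar R :=
  (Num.max (- F eta mu x y t v) 0)%:E.
Definition fabs6 (F : R -> R -> R -> R -> R -> R -> R) eta mu x y t v : \bar R :=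
  `|F eta mu x y t v|%:E.

Section signed.
Variable F : I1 -> I2 -> I3 -> R -> R -> R -> R -> R -> R -> R.
Hypothesis mF : forall al be ga, measurable6 (F al be ga).

Let Fp al be ga := fpos6 (F al be ga).
Let Fn al be ga := fneg6 (F al be ga).

Let mFp al be ga : measurable6 (Fp al be ga).
Proof.
apply/measurable_EFinP; apply: measurable_maxr; last exact: measurable_cst.
exact: mF.
Qed.

Let mFn al be ga : measurable6 (Fn al be ga).
Proof.
apply/measurable_EFinP; apply: measurable_maxr; last exact: measurable_cst.
by apply: measurable_funN; exact: mF.
Qed.

Let Fp0 al be ga eta mu x y t v : (0 <= Fp al be ga eta mu x y t v)%E.
Proof. by rewrite /Fp /fpos6 lee_fin le_max lexx orbT. Qed.

Let Fn0 al be ga eta mu x y t v : (0 <= Fn al be ga eta mu x y t v)%E.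
Proof. by rewrite /Fn /fneg6 lee_fin le_max lexx orbT. Qed.

Let Fp_le al be ga eta mu x y t v :
  (Fp al be ga eta mu x y t v <= fabs6 (F al be ga) eta mu x y t v)%E.
Proof. by rewrite lee_fin ge_max ler_norm normr_ge0. Qed.

Let Fn_le al be ga eta mu x y t v :
  (Fn al be ga eta mu x y t v <= fabs6 (F al be ga) eta mu x y t v)%E.
Proof. by rewrite lee_fin ge_max -normrN ler_norm normr_ge0. Qed.

Lemma Repr_opL : Repr (fun z : R * R => opL F z.1 z.2)
  (fun z => eopL Fp z.1 z.2) (fun z => eopL Fn z.1 z.2).
Proof.
rewrite /opL /eopL.
apply: Repr_sum => al; apply: Repr_sum => k; apply: Repr_sum => r.
apply: Repr_gint; first by mgf.
apply: Repr_gint; first by mgf.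
apply: Repr_sum => be.
apply: Repr_gint; first by mgf.
apply: Repr_gint; first by mgf.
apply: Repr_sum => ga.
apply: Repr_base.
by apply: (measurable_comp6 (mF al be ga)); mproj.
Qed.

Lemma Repr_opR : Repr (fun z : R * R => opR F z.1 z.2)
  (fun z => eopR Fp z.1 z.2) (fun z => eopR Fn z.1 z.2).
Proof.
rewrite /opR /eopR /eopR1.
apply: Repr_sum => al; apply: Repr_sum => be; apply: Repr_sum => ga.
apply: Repr_gint; first by mgf.
apply: Repr_gint; first by mgf.
apply: Repr_gint; first by mgf.
apply: Repr_gint; first by mgf.
apply: Repr_base.
by apply: (measurable_comp6 (mF al be ga)); mproj.
Qed.

Hypothesis Foo : forall al be ga,
  (egint a b gunit (fun eta => egint c d gunit (fun mu =>
    eopR1 be (fabs6 (F al be ga)) eta mu)) < +oo)%E.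

Let mFa al be ga : measurable6 (fabs6 (F al be ga)).
Proof. by apply/measurable_EFinP; apply: measurableT_comp => //; exact: mF. Qed.

Let le_eopR1 al be ga (G : R -> R -> R -> R -> R -> R -> \bar R) :
  measurable6 G -> (forall eta mu x y t v, 0 <= G eta mu x y t v)%E ->
  (forall eta mu x y t v, G eta mu x y t v <= fabs6 (F al be ga) eta mu x y t v)%E ->
  (egint a b gunit (fun eta => egint c d gunit (fun mu => eopR1 be G eta mu)) < +oo)%E.
Proof.
move=> mG G0 GF; apply: le_lt_trans (Foo al be ga).
have F0 eta mu x y t v : (0 <= fabs6 (F al be ga) eta mu x y t v)%E by rewrite lee_fin.
rewrite /eopR1.
have mH := mFa al be ga.
Ltac nng0 G0 F0 := repeat first [exact: G0|exact: F0|move=> ?|apply: egint_ge0; [gp|]].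
Ltac mes0 G H mG mH G0 F0 := repeat first
  [apply: (measurable_comp6 (F := G) mG); mproj
  |apply: (measurable_comp6 (F := H) mH); mproj
  |apply: measurable_egint; [mgf| |nng0 G0 F0] => /=].
(* The six layers are those of $\eta$, $\mu$, $x$, $y$, $t$, $v$. *)
do 6 (apply: le_egint; [gp|mes0 G (fabs6 (F al be ga)) mG mH G0 F0
  |mes0 G (fabs6 (F al be ga)) mG mH G0 F0|nng0 G0 F0|move=> ?]).
exact: GF.
Qed.

Let integral_eopLR (G : I1 -> I2 -> I3 -> R -> R -> R -> R -> R -> R -> \bar R) :
  (forall al be ga, measurable6 (G al be ga)) ->
  (forall al be ga eta mu x y t v, 0 <= G al be ga eta mu x y t v)%E ->
  (forall al be ga eta mu x y t v, G al be ga eta mu x y t v <=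
    fabs6 (F al be ga) eta mu x y t v)%E ->
  (\int[@leb2 R]_(z in rect a b c d) eopL G z.1 z.2 =
   \int[@leb2 R]_(z in rect a b c d) eopR G z.1 z.2)%E /\
  (\int[@leb2 R]_(z in rect a b c d) eopL G z.1 z.2 < +oo)%E.
Proof.
move=> mG G0 GF.
have EL : (\int[@leb2 R]_(z in rect a b c d) eopL G z.1 z.2 = \sum_al \sum_be \sum_ga
   egint a b gunit (fun eta => egint c d gunit (fun mu => eopR1 be (G al be ga) eta mu)))%E.
  rewrite integral_rect; [exact: integral_eopL|exact: measurable_eopL|].
  by move=> x y; exact: eopL_ge0.
have ER : (\int[@leb2 R]_(z in rect a b c d) eopR G z.1 z.2 = \sum_al \sum_be \sum_ga
   egint a b gunit (fun eta => egint c d gunit (fun mu => eopR1 be (G al be ga) eta mu)))%E.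
  rewrite integral_rect; [exact: integral_eopR|exact: measurable_eopR|].
  by move=> x y; do 3 apply: sume_ge0 => ? _; exact: eopR1_ge0.
split; first by rewrite EL ER.
rewrite EL; apply: lte_sum_pinfty => al _; apply: lte_sum_pinfty => be _.
apply: lte_sum_pinfty => ga _; apply: le_eopR1; [exact: mG|exact: G0|exact: GF].
Qed.

(** Both orders have the same positive total and the same negative total, all finite, so the
    difference formulas from [Repr_opL] and [Repr_opR] agree. *)
Lemma integral_opL_opR : \int[@leb2 R]_(z in rect a b c d) opL F z.1 z.2 =
  \int[@leb2 R]_(z in rect a b c d) opR F z.1 z.2.
Proof.
have [_ HL] := repr_diff_rect a b c d Repr_opL.
have [_ HR] := repr_diff_rect a b c d Repr_opR.
have [Ep Epoo] := integral_eopLR mFp Fp0 Fp_le.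
have [En Enoo] := integral_eopLR mFn Fn0 Fn_le.
have Rp : (\int[@leb2 R]_(z in rect a b c d) eopR Fp z.1 z.2 < +oo)%E by rewrite -Ep.
have Rn : (\int[@leb2 R]_(z in rect a b c d) eopR Fn z.1 z.2 < +oo)%E by rewrite -En.
apply: EFin_inj; apply: (etrans (HL Epoo Enoo)).
exact: (etrans (congr2 (fun x y => x - y)%E Ep En) (esym (HR Rp Rn))).
Qed.

Lemma integral_abs_opL_lty :
  (\int[@leb2 R]_(z in rect a b c d) `|opL F z.1 z.2|%:E < +oo)%E.
Proof.
have [mL mp mn H] := Repr_opL.
have [_ Epoo] := integral_eopLR mFp Fp0 Fp_le.
have [_ Enoo] := integral_eopLR mFn Fn0 Fn_le.
have mr := measurable_rect a b c d.
apply: (@le_lt_trans _ _ (\int[@leb2 R]_(z in rect a b c d)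
   (eopL Fp z.1 z.2 + eopL Fn z.1 z.2))%E).
  apply: ge0_le_integral.
  - exact: mr.
  - by move=> z _; rewrite lee_fin.
  - apply/measurable_EFinP; apply: measurableT_comp => //.
    exact: measurable_funS mL.
  - by apply: emeasurable_funD; [exact: measurable_funS mp|exact: measurable_funS mn].
  - by move=> z _; case: (H z) => _ _ [].
rewrite ge0_integralD.
- exact: (lte_add_pinfty Epoo Enoo).
- exact: mr.
- by move=> z _; exact: (eopL_ge0 Fp0).
- exact: measurable_funS mp.
- by move=> z _; exact: (eopL_ge0 Fn0).
- exact: measurable_funS mn.
Qed.

End signed.
End abstract_adjoint.

(** * The bilinear form of a positive semidefinite matrix *)

Lemma sum_pair (V : nmodType) (I J : finType) (f : I * J -> V) :
  \sum_z f z = \sum_i \sum_j f (i, j).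
Proof. by rewrite pair_bigA; apply: eq_bigr => -[]. Qed.

(** [bar] swaps 1 and 2, hence permutes the range of summation. *)
Lemma sum_bar (V : nmodType) (f : nat -> V) :
  \sum_(i < 3) f (bar i) = \sum_(i < 3) f i.
Proof. by rewrite (sum3E (fun i => f (bar i))) sum3E /= addrAC. Qed.

(** The index maps [k] and [l] are arbitrary, since a repeated index just adds coefficients. The
    form can thus be expanded over block positions without inverting [blk_idx] or [pos]. *)
Lemma form_sum_delta (R : realType) (m : nat) (P : 'M[R]_m) (I J : finType)
    (f : I -> R) (g : J -> R) (k : I -> 'I_m) (l : J -> 'I_m) :
  ((\sum_x f x *: delta_mx (k x) (0 : 'I_1))^T *m P *m
   (\sum_y g y *: delta_mx (l y) (0 : 'I_1))) 0 0 =
  \sum_x \sum_y f x * g y * P (k x) (l y).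
Proof.
have T : (\sum_x f x *: delta_mx (k x) (0 : 'I_1))^T =
    \sum_x f x *: delta_mx (0 : 'I_1) (k x) :> 'M[R]_(1, m).
  apply/matrixP => u v; rewrite mxE !summxE; apply: eq_bigr => x _.
  by rewrite !mxE andbC.
rewrite T !mulmx_suml summxE; apply: eq_bigr => x _.
rewrite -!scalemxAl -rowE mulmx_sumr mxE summxE mulr_sumr.
apply: eq_bigr => y _; rewrite -scalemxAr mxE -colE !mxE; ring.
Qed.

Section bilinear.
Context {R : realType}.
Variables a b c d : R.
Variables q n : nat.
Variable P : 'M[R]_(9 * q).
Variable G : R -> R -> R.
Variable A : nat -> nat -> 'I_q -> 'I_n -> R -> R -> R -> R -> R.
Local Arguments egint : simpl never.
Local Arguments gint : simpl never.

(** Indices of one scalar term: [I2] holds a component of [U] and the exponents $(i,j,p,s)$, [I3] a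
    position inside a block of [P]. The function [A i j ga al] stands for the entry of $Z_{ij}$ in
    row [ga] and column [al]. *)
Let I2 : finType := ('I_n * ('I_3 * 'I_3 * 'I_3 * 'I_3))%type.
Let I3 : finType := ('I_q * 'I_q)%type.
Definition idx_i (k : I2) : nat := k.2.1.1.1.
Definition idx_j (k : I2) : nat := k.2.1.1.2.
Definition idx_p (k : I2) : nat := k.2.1.2.
Definition idx_s (k : I2) : nat := k.2.2.

Definition Pcoef (be : I2) (ga : I3) : R :=
  blk P (pos (bar (idx_i be)) (bar (idx_p be))) (pos (idx_j be) (idx_s be)) ga.1 ga.2.

Definition bil_integrand (V U : 'I_n -> R -> R -> R) (al : 'I_n) (be : I2) (ga : I3)
    (eta mu x y t v : R) : R :=
  (G eta mu * Pcoef be ga) *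
  ((A (bar (idx_i be)) (bar (idx_p be)) ga.1 al eta mu x y * V al x y) *
   (A (idx_j be) (idx_s be) ga.2 be.1 eta mu t v * U be.1 t v)).

(** Component [al] of the operator given by [P], with layers in place of truncated integrals and
    with abstract data [G], [A], [U] that can be taken measurable on the whole space. *)
Definition opT (U : 'I_n -> R -> R -> R) (al : 'I_n) (x y : R) : R :=
  \sum_(k < 3) \sum_(r < 3)
    gint a b (part_gfun k x) (fun t => gint c d (part_gfun r y) (fun v =>
    \sum_(be < n) (\sum_(i < 3) \sum_(j < 3) \sum_(p < 3) \sum_(s < 3)
      gint a b (Psi k i j x t) (fun eta => gint c d (Psi r p s y v) (fun mu =>
      G eta mu * \sum_(de < q)
        (\sum_(ga < q) A (bar i) (bar p) ga al eta mu x y *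
          blk P (pos (bar i) (bar p)) (pos j s) ga de) * A j s de be eta mu t v)))
      * U be t v)).

(** [opL] keeps its sums inside the integrals exactly where [opT] has them. Only the factors [V] and
    [U] cross integral signs, so the identity holds at every point, whether or not the integrals
    converge. *)
Lemma opL_bil_integrand V U x y :
  opL a b c d idx_i idx_j idx_p idx_s (bil_integrand V U) x y = \sum_al V al x y * opT U al x y.
Proof.
apply: eq_bigr => al _; rewrite /opT mulr_sumr; apply: eq_bigr => k _.
rewrite mulr_sumr; apply: eq_bigr => r _.
rewrite -gintZl; congr gint; apply/funext => t.
rewrite -gintZl; congr gint; apply/funext => v.
rewrite mulr_sumr sum_pair; apply: eq_bigr => be _; rewrite mulr_suml mulr_sumr.
rewrite 3!sum_pair.
apply: eq_bigr => i _; rewrite mulr_suml mulr_sumr; apply: eq_bigr => j _.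
rewrite mulr_suml mulr_sumr; apply: eq_bigr => p _.
rewrite mulr_suml mulr_sumr; apply: eq_bigr => s _.
rewrite -gintZr -gintZl; congr gint; apply/funext => eta.
rewrite -gintZr -gintZl; congr gint; apply/funext => mu.
rewrite sum_pair exchange_big mulr_sumr mulr_suml mulr_sumr; apply: eq_bigr => de _.
rewrite !mulr_suml !mulr_sumr mulr_suml mulr_sumr; apply: eq_bigr => ga _.
rewrite /bil_integrand /Pcoef /idx_i /idx_j /idx_p /idx_s /=; ring.
Qed.

(** The sum over components stays outside the integrals. This matches [opR], and the expansion of
    the form then uses no additivity of integrals. *)
Definition coefA (U : 'I_n -> R -> R -> R) (i j : nat) (ga : 'I_q) (eta mu : R) : R :=
  \sum_al gint a b (part_gfun i eta) (fun x => gint c d (part_gfun j mu) (fun y =>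
    A i j ga al eta mu x y * U al x y)).

Definition vecA (U : 'I_n -> R -> R -> R) (eta mu : R) : 'cV[R]_(9 * q) :=
  \sum_(k : 'I_3 * 'I_3 * 'I_q)
    coefA U k.1.1 k.1.2 k.2 eta mu *: delta_mx (blk_idx (pos k.1.1 k.1.2) k.2) 0.

Lemma gint4M al be al' be' (psi1 psi2 psi3 psi4 : gfun R) (k : R) (f h : R -> R -> R) :
  gint al be psi1 (fun x => gint al' be' psi2 (fun y =>
    gint al be psi3 (fun t => gint al' be' psi4 (fun v => k * (f x y * h t v))))) =
  k * (gint al be psi1 (fun x => gint al' be' psi2 (f x)) *
       gint al be psi3 (fun t => gint al' be' psi4 (h t))).
Proof.
rewrite -gintZr -gintZl; congr gint; apply/funext => x.
rewrite -gintZr -gintZl; congr gint; apply/funext => y.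
rewrite -gintZl -gintZl; congr gint; apply/funext => t.
by rewrite -gintZl -gintZl; congr gint.
Qed.

(** For each choice of indices the integral splits into a product, because $(x,y)$ and $(t,v)$ are
    independent once $(\eta,\mu)$ is fixed. The rest is finite reindexing. *)
Lemma opR_bil_integrand V U eta mu :
  opR a b c d idx_i idx_j idx_p idx_s (bil_integrand V U) eta mu =
  G eta mu * ((vecA V eta mu)^T *m P *m vecA U eta mu) 0 0.
Proof.
rewrite /vecA form_sum_delta mulr_sumr.
pose X (i p j s : nat) (al be : 'I_n) (ga de : 'I_q) : R :=
  G eta mu * blk P (pos i p) (pos j s) ga de *
  (gint a b (part_gfun i eta) (fun x => gint c d (part_gfun p mu) (fun y =>
    A i p ga al eta mu x y * V al x y)) *
   gint a b (part_gfun j eta) (fun t => gint c d (part_gfun s mu) (fun v =>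
    A j s de be eta mu t v * U be t v))).
pose Y (i p j s : nat) := \sum_al \sum_be \sum_ga \sum_de X i p j s al be ga de.
transitivity (\sum_(i < 3) \sum_(j < 3) \sum_(p < 3) \sum_(s < 3) Y (bar i) (bar p) j s).
  rewrite /opR.
  under eq_bigr => al _ do rewrite sum_pair exchange_big /=.
  rewrite exchange_big 3!sum_pair /=.
  apply: eq_bigr => i _; apply: eq_bigr => j _; apply: eq_bigr => p _.
  apply: eq_bigr => s _; apply: eq_bigr => al _; apply: eq_bigr => be _.
  rewrite sum_pair; apply: eq_bigr => ga _; apply: eq_bigr => de _.
  by rewrite gint4M.
(* Renaming $\bar i,\bar p$ to $i,p$ makes the rows of [P] range over the same nine blocks as its
   columns, so that a genuine form of [P] appears. *)
transitivity (\sum_(i < 3) \sum_(p < 3) \sum_(j < 3) \sum_(s < 3) Y i p j s).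
  rewrite -(sum_bar (fun i => \sum_(p < 3) \sum_(j < 3) \sum_(s < 3) Y i p j s)).
  apply: eq_bigr => i _; rewrite exchange_big.
  by rewrite -(sum_bar (fun p => \sum_(j < 3) \sum_(s < 3) Y (bar i) p j s)).
rewrite 2!sum_pair; apply: eq_bigr => i _; apply: eq_bigr => p _.
transitivity (\sum_ga \sum_(j < 3) \sum_(s < 3) \sum_de \sum_al \sum_be X i p j s al be ga de).
  rewrite [RHS]exchange_big; apply: eq_bigr => j _.
  rewrite [RHS]exchange_big; apply: eq_bigr => s _.
  rewrite /Y; under eq_bigr => al _ do rewrite exchange_big.
  rewrite exchange_big; apply: eq_bigr => ga _.
  under eq_bigr => al _ do rewrite exchange_big.
  by rewrite exchange_big.
apply: eq_bigr => ga _; rewrite mulr_sumr 2!sum_pair.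
apply: eq_bigr => j _; apply: eq_bigr => s _; apply: eq_bigr => de _ /=.
rewrite /coefA !mulr_suml mulr_sumr; apply: eq_bigr => al _.
rewrite mulr_sumr mulr_suml mulr_sumr; apply: eq_bigr => be _.
by rewrite /X mxE; ring.
Qed.

(** * Absolute convergence of the bilinear form *)

Lemma egint4M (psi1 psi2 psi3 psi4 : gfun R) (k : R) (f h : R -> R -> \bar R) :
  gpos psi1 -> gpos psi2 -> gpos psi3 -> gpos psi4 -> 0 <= k ->
  measurable_fun setT (fun z : R * R => f z.1 z.2) ->
  measurable_fun setT (fun z : R * R => h z.1 z.2) ->
  (forall x y, 0 <= f x y)%E -> (forall x y, 0 <= h x y)%E ->
  egint a b psi1 (fun x => egint c d psi2 (fun y =>
    egint a b psi3 (fun t => egint c d psi4 (fun v => (k%:E * (f x y * h t v))%E)))) =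
  (k%:E * (egint a b psi1 (fun x => egint c d psi2 (f x)) *
       egint a b psi3 (fun t => egint c d psi4 (h t))))%E.
Proof.
move=> g1 g2 g3 g4 k0 mf mh f0 h0.
have mcst (psi : gfun R) : gpos psi -> mgfun (fun _ : R => psi).
  case: psi => [p0 _|h1 [mh1 h10]].
    by left; exists (fun=> p0) => //; exact: measurable_cst.
  right; exists (fun=> h1); split => //.
  by apply: (measurableT_comp mh1); mproj.
have mf1 x : measurable_fun setT (f x) by apply: (measurable_comp2 mf); mproj.
have mh1 x : measurable_fun setT (h x) by apply: (measurable_comp2 mh); mproj.
set Z := egint a b psi3 (fun t => egint c d psi4 (h t)).
have Z0 : (0 <= Z)%E by apply: egint_ge0 => // t; exact: egint_ge0.
have mH : measurable_fun setT (fun t => egint c d psi4 (h t)).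
  by apply: measurable_egint => //; exact: mcst.
have mFF : measurable_fun setT (fun x => egint c d psi2 (f x)).
  by apply: measurable_egint => //; exact: mcst.
transitivity (egint a b psi1 (fun x => egint c d psi2 (fun y => ((k%:E * Z) * f x y)%E))).
  apply: eq_egint => x; apply: eq_egint => y.
  transitivity (egint a b psi3 (fun t => ((k%:E * f x y) * egint c d psi4 (h t))%E)).
    apply: eq_egint => t; rewrite -egintZ//.
      by apply: eq_egint => v; rewrite muleA.
    by rewrite mule_ge0.
  rewrite egintZ//; first by rewrite -/Z muleAC.
  - by move=> t; exact: egint_ge0.
  - by rewrite mule_ge0.
transitivity (egint a b psi1 (fun x => ((k%:E * Z) * egint c d psi2 (f x))%E)).
  apply: eq_egint => x; apply: egintZ => //.
  by rewrite mule_ge0.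
rewrite egintZ//.
- by rewrite -muleA (muleC Z).
- by move=> x; exact: egint_ge0.
- by rewrite mule_ge0.
Qed.

Section estimates.
Hypothesis mG : measurable_fun setT (fun z : R * R => G z.1 z.2).
Hypothesis G0 : forall x y, 0 <= G x y.
Hypothesis mA : forall i j ga al, measurable_fun setT
  (fun z : R * R * R * R => A i j ga al z.1.1.1 z.1.1.2 z.1.2 z.2).

Definition normA (U : 'I_n -> R -> R -> R) (i j : nat) (ga : 'I_q) (al : 'I_n)
    (eta mu : R) : \bar R :=
  egint a b (part_gfun i eta) (fun t => egint c d (part_gfun j mu) (fun v =>
    `|A i j ga al eta mu t v * U al t v|%:E)).

(** Well-posedness entry by entry, for the abstract data. *)
Definition finiteA (U : 'I_n -> R -> R -> R) :=
  forall (i j : nat) ga al, (i < 3)%N -> (j < 3)%N ->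
  (egint a b gunit (fun eta => egint c d gunit (fun mu =>
    (G eta mu)%:E * normA U i j ga al eta mu ^+ 2)) < +oo)%E.

Lemma normA_ge0 U i j ga al eta mu : (0 <= normA U i j ga al eta mu)%E.
Proof.
apply: egint_ge0 => [|t]; first by gp.
by apply: egint_ge0 => [|v]; [gp|rewrite lee_fin].
Qed.

Variables U V : 'I_n -> R -> R -> R.
Hypothesis mU : forall k, measurable_fun setT (fun z : R * R => U k z.1 z.2).
Hypothesis mV : forall k, measurable_fun setT (fun z : R * R => V k z.1 z.2).

Lemma measurable_bil_integrand al be ga : measurable6 (bil_integrand V U al be ga).
Proof.
apply: measurable_funM.
  apply: measurable_funM; last exact: measurable_cst.
  by apply: (measurable_comp2 mG); mproj.
apply: measurable_funM; apply: measurable_funM.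
- by apply: (measurable_comp4 (mA _ _ _ _)); mproj.
- by apply: (measurable_comp2 (mV _)); mproj.
- by apply: (measurable_comp4 (mA _ _ _ _)); mproj.
- by apply: (measurable_comp2 (mU _)); mproj.
Qed.

Lemma measurable_AU W i j ga al : measurable_fun setT (fun z : R * R => W al z.1 z.2) ->
  measurable_fun setT (fun z : R * R * R * R =>
    `|A i j ga al z.1.1.1 z.1.1.2 z.1.2 z.2 * W al z.1.2 z.2|%:E).
Proof.
move=> mW; apply/measurable_EFinP; apply: measurableT_comp => //.
apply: measurable_funM; first exact: mA.
by apply: (measurable_comp2 mW); mproj.
Qed.

Lemma measurable_normA W i j ga al : measurable_fun setT (fun z : R * R => W al z.1 z.2) ->
  measurable_fun setT (fun z : R * R => normA W i j ga al z.1 z.2).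
Proof.
move=> mW; apply: measurable_egint; first by mgf.
- apply: (@measurable_egint R _ _ c d (fun z : R * R * R => part_gfun j z.1.2)
    (fun z v => `|A i j ga al z.1.1 z.1.2 z.2 v * W al z.2 v|%:E)).
  + by mgf.
  + exact: measurable_AU.
  + by move=> *; rewrite lee_fin.
- by move=> z t; apply: egint_ge0 => [|v]; [gp|rewrite lee_fin].
Qed.

Lemma bar_lt3 (i : nat) : (bar i < 3)%N.
Proof. by case: i => [|[|]]. Qed.

(** Infinite values rule out expanding $(x-y)^2$; instead, the product is at most the square of the
    larger factor. *)
Lemma le_mule_sqr (x y : \bar R) : (0 <= x)%E -> (0 <= y)%E ->
  (x * y <= x ^+ 2 + y ^+ 2)%E.
Proof.
move=> x0 y0; rewrite !expe2; case: (leP x y) => xy.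
  by apply: (@le_trans _ _ (y * y)%E); [exact: lee_wpmul2r|rewrite leeDr// mule_ge0].
apply: (@le_trans _ _ (x * x)%E); last by rewrite leeDl// mule_ge0.
by apply: lee_wpmul2l => //; exact: ltW.
Qed.

Hypotheses (fU : finiteA U) (fV : finiteA V).

Lemma bil_integrand_lty al be ga : (egint a b gunit (fun eta => egint c d gunit (fun mu =>
  eopR1 a b c d idx_i idx_j idx_p idx_s be (fabs6 (bil_integrand V U al be ga)) eta mu)) < +oo)%E.
Proof.
pose X := normA V (bar (idx_i be)) (bar (idx_p be)) ga.1 al.
pose Y := normA U (idx_j be) (idx_s be) ga.2 be.1.
have X0 eta mu : (0 <= X eta mu)%E by exact: normA_ge0.
have Y0 eta mu : (0 <= Y eta mu)%E by exact: normA_ge0.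
have mX : measurable_fun setT (fun z : R * R => X z.1 z.2).
  by apply: measurable_normA; exact: mV.
have mY : measurable_fun setT (fun z : R * R => Y z.1 z.2).
  by apply: measurable_normA; exact: mU.
pose C : R := `|Pcoef be ga|.
pose X2 eta mu := ((G eta mu)%:E * X eta mu ^+ 2)%E.
pose Y2 eta mu := ((G eta mu)%:E * Y eta mu ^+ 2)%E.
have X20 eta mu : (0 <= X2 eta mu)%E.
  by rewrite mule_ge0 ?lee_fin// expe2 mule_ge0.
have Y20 eta mu : (0 <= Y2 eta mu)%E.
  by rewrite mule_ge0 ?lee_fin// expe2 mule_ge0.
have mEG : measurable_fun setT (fun z : R * R => (G z.1 z.2)%:E).
  exact/measurable_EFinP.
have mX2 : measurable_fun setT (fun z : R * R => X2 z.1 z.2).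
  by apply: emeasurable_funM => //; apply: emeasurable_funM.
have mY2 : measurable_fun setT (fun z : R * R => Y2 z.1 z.2).
  by apply: emeasurable_funM => //; apply: emeasurable_funM.
(* The integral of absolute values factors: [X] collects the integrals of [V] at the barred
   exponents, [Y] those of [U]. *)
have E4 eta mu : eopR1 a b c d idx_i idx_j idx_p idx_s be (fabs6 (bil_integrand V U al be ga)) eta mu =
    ((C * G eta mu)%:E * (X eta mu * Y eta mu))%E.
  rewrite /eopR1 /fabs6 /bil_integrand /X /Y /normA -egint4M.
  - apply: eq_egint => x; apply: eq_egint => y; apply: eq_egint => t.
    apply: eq_egint => v.
    by rewrite -!EFinM !normrM (ger0_norm (G0 _ _)) (mulrC (G _ _)).
  - by gp.
  - by gp.
  - by gp.
  - by gp.
  - by rewrite mulr_ge0 ?normr_ge0.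
  - have mm := measurable_AU (bar (idx_i be)) (bar (idx_p be)) ga.1 (mV al).
    by apply: (measurable_comp4 (F := fun p1 p2 p3 p4 =>
      `|A (bar (idx_i be)) (bar (idx_p be)) ga.1 al p1 p2 p3 p4 * V al p3 p4|%:E) mm); mproj.
  - have mm := measurable_AU (idx_j be) (idx_s be) ga.2 (mU be.1).
    by apply: (measurable_comp4 (F := fun p1 p2 p3 p4 =>
      `|A (idx_j be) (idx_s be) ga.2 be.1 p1 p2 p3 p4 * U be.1 p3 p4|%:E) mm); mproj.
  - by move=> *; rewrite lee_fin.
  - by move=> *; rewrite lee_fin.
have mXYsum : measurable_fun setT (fun z : R * R => C%:E * (X2 z.1 z.2 + Y2 z.1 z.2))%E.
  by apply: measurable_funeM; exact: emeasurable_funD.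
have XY0 eta mu : (0 <= C%:E * (X2 eta mu + Y2 eta mu))%E.
  by rewrite mule_ge0 ?lee_fin ?normr_ge0// adde_ge0.
have mL : measurable_fun setT (fun z : R * R =>
    ((C * G z.1 z.2)%:E * (X z.1 z.2 * Y z.1 z.2))%E).
  apply: emeasurable_funM; last exact: emeasurable_funM.
  by apply/measurable_EFinP; apply: measurable_funM => //; exact: measurable_cst.
have L0 eta mu : (0 <= (C * G eta mu)%:E * (X eta mu * Y eta mu))%E.
  by rewrite mule_ge0// ?mule_ge0// lee_fin mulr_ge0// normr_ge0.
apply: (@le_lt_trans _ _ (egint a b gunit (fun eta => egint c d gunit (fun mu =>
    (C%:E * (X2 eta mu + Y2 eta mu))%E)))).
  have -> : (fun eta => egint c d gunit (fun mu =>
     eopR1 a b c d idx_i idx_j idx_p idx_s be (fabs6 (bil_integrand V U al be ga)) eta mu)) =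
     (fun eta => egint c d gunit (fun mu => ((C * G eta mu)%:E * (X eta mu * Y eta mu))%E)).
    by apply/funext => eta; apply: eq_egint => mu; exact: E4.
  apply: le_egint; [gp| | | |].
  - by apply: measurable_egint; [mgf|exact: mL|exact: L0].
  - by apply: measurable_egint; [mgf|exact: mXYsum|exact: XY0].
  - by move=> eta; apply: egint_ge0; [gp|exact: L0].
  move=> eta; apply: le_egint; [gp| | |exact: L0|].
  - by apply: (measurable_comp2 (F := fun eta mu => ((C * G eta mu)%:E * (X eta mu * Y eta mu))%E) mL); mproj.
  - by apply: (measurable_comp2 (F := fun eta mu => (C%:E * (X2 eta mu + Y2 eta mu))%E) mXYsum); mproj.
  move=> mu; rewrite EFinM -muleA; apply: lee_wpmul2l; first by rewrite lee_fin normr_ge0.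
  rewrite /X2 /Y2 -ge0_muleDr; [|by rewrite expe2 mule_ge0|by rewrite expe2 mule_ge0].
  by apply: lee_wpmul2l; [rewrite lee_fin|exact: le_mule_sqr].
have mEX : measurable_fun setT (fun eta => egint c d gunit (X2 eta)).
  by apply: measurable_egint; [mgf|exact: mX2|exact: X20].
have mEY : measurable_fun setT (fun eta => egint c d gunit (Y2 eta)).
  by apply: measurable_egint; [mgf|exact: mY2|exact: Y20].
have EX0 eta : (0 <= egint c d gunit (X2 eta))%E by apply: egint_ge0; [gp|exact: X20].
have EY0 eta : (0 <= egint c d gunit (Y2 eta))%E by apply: egint_ge0; [gp|exact: Y20].
have mX2' eta : measurable_fun setT (X2 eta) by apply: (measurable_comp2 mX2); mproj.
have mY2' eta : measurable_fun setT (Y2 eta) by apply: (measurable_comp2 mY2); mproj.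
have -> : egint a b gunit (fun eta => egint c d gunit (fun mu =>
    (C%:E * (X2 eta mu + Y2 eta mu))%E)) =
  (C%:E * (egint a b gunit (fun eta => egint c d gunit (X2 eta)) +
           egint a b gunit (fun eta => egint c d gunit (Y2 eta))))%E.
  have C0 : (0 <= C%:E)%E by rewrite lee_fin normr_ge0.
  have D1 eta : egint c d gunit (fun mu => (C%:E * (X2 eta mu + Y2 eta mu))%E) =
      (C%:E * (egint c d gunit (X2 eta) + egint c d gunit (Y2 eta)))%E.
    have mD : measurable_fun setT (fun mu => (X2 eta mu + Y2 eta mu)%E).
      exact: (emeasurable_funD (mX2' eta) (mY2' eta)).
    have D0 mu : (0 <= X2 eta mu + Y2 eta mu)%E by rewrite adde_ge0.
    rewrite (egintZ c d (unit_gpos : gpos (gunit : gfun R)) mD D0 C0).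
    by rewrite (egintD c d (unit_gpos : gpos (gunit : gfun R)) (mX2' eta) (X20 eta) (mY2' eta) (Y20 eta)).
  have mD : measurable_fun setT
      (fun eta => (egint c d gunit (X2 eta) + egint c d gunit (Y2 eta))%E).
    exact: (emeasurable_funD mEX mEY).
  have D0 eta : (0 <= egint c d gunit (X2 eta) + egint c d gunit (Y2 eta))%E.
    by rewrite adde_ge0.
  rewrite (funext D1).
  rewrite (egintZ a b (unit_gpos : gpos (gunit : gfun R)) mD D0 C0).
  by rewrite (egintD a b (unit_gpos : gpos (gunit : gfun R)) mEX EX0 mEY EY0).
apply: lte_mul_pinfty; [by rewrite lee_fin normr_ge0|by []|].
apply: lte_add_pinfty.
- apply: fV; exact: bar_lt3.
- apply: fU; exact: ltn_ord.
Qed.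

End estimates.
End bilinear.

Section bilinear_consequences.
Context {R : realType}.
Variables a b c d : R.
Variables q n : nat.
Variable P : 'M[R]_(9 * q).
Variable G : R -> R -> R.
Variable A : nat -> nat -> 'I_q -> 'I_n -> R -> R -> R -> R -> R.
Hypothesis mG : measurable_fun setT (fun z : R * R => G z.1 z.2).
Hypothesis G0 : forall x y, 0 <= G x y.
Hypothesis mA : forall i j ga al, measurable_fun setT
  (fun z : R * R * R * R => A i j ga al z.1.1.1 z.1.1.2 z.1.2 z.2).
Variables U V : 'I_n -> R -> R -> R.
Hypothesis mU : forall k, measurable_fun setT (fun z : R * R => U k z.1 z.2).
Hypothesis mV : forall k, measurable_fun setT (fun z : R * R => V k z.1 z.2).

Lemma measurable_opT al :
  measurable_fun setT (fun z : R * R => opT a b c d P G A U al z.1 z.2).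
Proof.
(* A constant unit vector as test function isolates component [al] of [opT] inside [opL]. *)
pose W (k : 'I_n) (x y : R) : R := (k == al)%:R.
have mW k : measurable_fun setT (fun z : R * R => W k z.1 z.2) by exact: measurable_cst.
have [mL _ _ _] := Repr_opL a b c d (@idx_i n) (@idx_j n) (@idx_p n) (@idx_s n) (measurable_bil_integrand P mG mA mU mW).
apply: eq_measurable_fun mL => z _; rewrite opL_bil_integrand (bigD1 al)//= /W eqxx mul1r.
by rewrite big1 ?addr0// => k /negbTE ->; rewrite mul0r.
Qed.

Hypotheses (fU : finiteA a b c d G A U) (fV : finiteA a b c d G A V).
Let mF := measurable_bil_integrand P mG mA mU mV.
Let Foo := bil_integrand_lty P mG G0 mA mU mV fU fV.

Lemma integral_opT :
  \int[@leb2 R]_(z in rect a b c d) (\sum_al V al z.1 z.2 * opT a b c d P G A U al z.1 z.2) =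
  \int[@leb2 R]_(z in rect a b c d) (G z.1 z.2 *
    ((vecA a b c d A V z.1 z.2)^T *m P *m vecA a b c d A U z.1 z.2) 0 0).
Proof.
have E : \int[@leb2 R]_(z in rect a b c d) opL a b c d (@idx_i n) (@idx_j n) (@idx_p n) (@idx_s n) (bil_integrand P G A V U) z.1 z.2 =
  \int[@leb2 R]_(z in rect a b c d) opR a b c d (@idx_i n) (@idx_j n) (@idx_p n) (@idx_s n) (bil_integrand P G A V U) z.1 z.2.
  apply: integral_opL_opR; [by move=> k; exact: ltn_ord|by move=> k; exact: ltn_ord
    |by move=> k; exact: ltn_ord|by move=> k; exact: ltn_ord|exact: mF|exact: Foo].
transitivity (\int[@leb2 R]_(z in rect a b c d)
   opL a b c d (@idx_i n) (@idx_j n) (@idx_p n) (@idx_s n) (bil_integrand P G A V U) z.1 z.2).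
  by apply: eq_Rintegral => z _; rewrite opL_bil_integrand.
apply: (etrans E).
by apply: eq_Rintegral => z _; rewrite opR_bil_integrand.
Qed.

Lemma integral_abs_opT_lty : (\int[@leb2 R]_(z in rect a b c d)
  `|\sum_al V al z.1 z.2 * opT a b c d P G A U al z.1 z.2|%:E < +oo)%E.
Proof.
have E : (\int[@leb2 R]_(z in rect a b c d)
    `|opL a b c d (@idx_i n) (@idx_j n) (@idx_p n) (@idx_s n) (bil_integrand P G A V U) z.1 z.2|%:E < +oo)%E.
  apply: integral_abs_opL_lty; [by move=> k; exact: ltn_ord|by move=> k; exact: ltn_ord
    |by move=> k; exact: ltn_ord|by move=> k; exact: ltn_ord|exact: mF|exact: Foo].
apply: le_lt_trans E; rewrite le_eqVlt; apply/orP; left; apply/eqP.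
by apply: eq_integral => z _; rewrite opL_bil_integrand.
Qed.

End bilinear_consequences.

(** * Truncated integrals as layers on a fixed interval *)

Section ranges.
Context {R : realType}.
Variables al be : R.
Local Notation leb := (@lebesgue_measure R).

(** A delta outside the interval would see values there. Excluding it permits replacing an integrand
    by one that agrees with it on the interval only. *)
Definition gfun_in (psi : gfun R) :=
  if psi is GDelta p then (al <= p) && (p <= be) else true.

Lemma eq_gint_in psi f g : gfun_in psi ->
  (forall s, (al <= s) && (s <= be) -> f s = g s) ->
  gint al be psi f = gint al be psi g.
Proof.
move=> psi_in fg; apply: eq_gint; last by move=> s s1 s2; rewrite fg// s1.
by case: psi psi_in => //= p pin; rewrite fg.
Qed.

Lemma eq_egint_in psi (f g : R -> \bar R) : gfun_in psi ->
  (forall s, (al <= s) && (s <= be) -> f s = g s) ->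
  egint al be psi f = egint al be psi g.
Proof.
move=> psi_in fg; apply: eq_itv_egint; last by move=> s s1 s2; rewrite fg// s1.
by case: psi psi_in => //= p pin; rewrite fg.
Qed.

Lemma part_in k x : (al <= x) && (x <= be) -> gfun_in (part_gfun k x).
Proof. by case: k => [|[|k]]. Qed.

Lemma Psi_in k i j x t : (al <= x) && (x <= be) -> (al <= t) && (t <= be) ->
  gfun_in (Psi k i j x t).
Proof.
by case: k => [|[|[|k]]]; case: i => [|[|[|i]]]; case: j => [|[|[|j]]].
Qed.

Lemma gint_part1 x f : (al <= x) && (x <= be) ->
  gint al be (part_gfun 1 x) f = \int[leb]_(s in `[al, x]) f s.
Proof.
move=> /andP[alx xbe]; rewrite /= [LHS]Rintegral_mkcond [RHS]Rintegral_mkcond.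
apply: eq_Rintegral => s _; rewrite /patch !mem_setE !in_itv /=.
case: (leP s x) => [sx|xs]; last by rewrite andbF mul0r; case: ifP.
by rewrite (le_trans sx xbe) mul1r andbT.
Qed.

Lemma gint_part2 x f : (al <= x) && (x <= be) ->
  gint al be (part_gfun 2 x) f = \int[leb]_(s in `[x, be]) f s.
Proof.
move=> /andP[alx xbe]; rewrite /= [LHS]Rintegral_mkcond [RHS]Rintegral_mkcond.
apply: eq_Rintegral => s _; rewrite /patch !mem_setE !in_itv /=.
case: (leP x s) => [xs|sx]; last by rewrite mul0r; case: ifP.
by rewrite (le_trans alx xs) mul1r.
Qed.

Lemma egint_part k x f : (al <= x) && (x <= be) ->
  egint al be (part_gfun k x) f = epart al be k x f.
Proof.
move=> /andP[alx xbe]; case: k => [//|[|k]] /=; rewrite [RHS]integral_mkcond;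
  apply: eq_integral => s _; rewrite /patch mem_setE in_itv /= /itvw.
  case: (leP s x) => [sx|xs]; last by rewrite andbF mulr0 mul0e.
  by rewrite (le_trans sx xbe) !andbT; case: ifP => _; rewrite ?mulr1 ?mul1e ?mul0r ?mul0e.
case: (leP x s) => [xs|sx]; last by rewrite mulr0 mul0e.
by rewrite (le_trans alx xs) /=; case: ifP => _; rewrite ?mulr1 ?mul1e ?mul0r ?mul0e.
Qed.

End ranges.

(** * Extension by zero outside the rectangle *)

Lemma patch_weight d (T : measurableType d) (R : realType) (D : set T) (w f : T -> R) :
  (forall z, w z = if z \in D then 1 else 0) -> f \_ D = fun z => w z * f z.
Proof.
by move=> wE; apply/funext => z; rewrite patchE wE; case: ifP; rewrite ?mul1r// mul0r.
Qed.

Lemma measurable_L2_weight d (T : measurableType d) (R : realType)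
    (mu : {measure set T -> \bar R}) (D : set T) (w f : T -> R) :
  L2_on mu D f -> (forall z, w z = if z \in D then 1 else 0) ->
  measurable_fun setT (fun z => w z * f z).
Proof. by move=> /L2_onP[mf _] wE; rewrite (patch_weight _ wE) in mf. Qed.

Lemma weight_setX d1 d2 (T1 : measurableType d1) (T2 : measurableType d2) (R : realType)
    (D1 : set T1) (D2 : set T2) (w1 : T1 -> R) (w2 : T2 -> R) :
  (forall z, w1 z = if z \in D1 then 1 else 0) ->
  (forall z, w2 z = if z \in D2 then 1 else 0) ->
  forall z, w1 z.1 * w2 z.2 = if z \in D1 `*` D2 then 1 else 0.
Proof.
move=> E1 E2 z; rewrite in_setX E1 E2.
by case: (z.1 \in D1); case: (z.2 \in D2); rewrite ?(mulr0, mul0r, mulr1).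
Qed.

Lemma weight_itv (R : realType) (al be : R) (z : R) :
  itvw al be z = if z \in `[al, be]%classic then 1 else 0.
Proof. by rewrite /itvw mem_setE in_itv. Qed.

Section cut.
Context {R : realType}.
Variables a b c d : R.
Local Notation rect := (rect a b c d).

Lemma weight_rect (z : R * R) : rectw a b c d z = if z \in rect then 1 else 0.
Proof. by apply: weight_setX; exact: weight_itv. Qed.

Lemma rectw1 x y : (a <= x) && (x <= b) -> (c <= y) && (y <= d) ->
  rectw a b c d (x, y) = 1.
Proof. by move=> hx hy; rewrite weight_rect mem_rect hx hy. Qed.

Definition cutf (f : R -> R -> R) (x y : R) : R := rectw a b c d (x, y) * f x y.

Lemma measurable_cutf f : L2_on (@leb2 R) rect (fun z => f z.1 z.2) ->
  measurable_fun setT (fun z : R * R => cutf f z.1 z.2).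
Proof.
move=> /L2_onP[mf _]; rewrite (patch_weight _ weight_rect) in mf.
by apply: eq_measurable_fun mf => -[x y] _.
Qed.

Variables (q n : nat) (Z : pi_array R q n).

(** Both pairs of variables are cut, even when $Z_{ij}$ ignores $t$ or $v$, so that all nine
    components are measurable functions of four variables and can be treated uniformly. *)
Definition cutZ (i j : nat) (ga : 'I_q) (al : 'I_n) (x y t v : R) : R :=
  rectw a b c d (x, y) * rectw a b c d (t, v) * pi_ker Z i j x y t v ga al.

(** The map [p] retains the variables on which a component depends; [w] is the indicator that square
    integrability provides there, and [w'] supplies the indicators of the missing variables. *)
Lemma measurable_weight4 (f : R -> R -> R -> R -> R) d' (X : measurableType d')
    (w h : X -> R) (p : R * R * R * R -> X) (w' : R * R * R * R -> R) :
  measurable_fun setT (fun z => w z * h z) ->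
  measurable_fun setT p -> measurable_fun setT w' ->
  (forall z, rectw a b c d (z.1.1.1, z.1.1.2) * rectw a b c d (z.1.2, z.2) =
    w' z * w (p z)) ->
  (forall z, f z.1.1.1 z.1.1.2 z.1.2 z.2 = h (p z)) ->
  measurable_fun setT (fun z : R * R * R * R =>
    rectw a b c d (z.1.1.1, z.1.1.2) * rectw a b c d (z.1.2, z.2) *
    f z.1.1.1 z.1.1.2 z.1.2 z.2).
Proof.
move=> mh mp mw' Ew Ef.
have m := measurable_funM mw' (measurableT_comp mh mp).
by apply: eq_measurable_fun m => z _ /=; rewrite Ew Ef mulrA.
Qed.

Lemma measurable_cutZ : N2D a b c d Z -> forall i j ga al, measurable_fun setT
  (fun z : R * R * R * R => cutZ i j ga al z.1.1.1 z.1.1.2 z.1.2 z.2).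
Proof.
move=> [[h00 h10 h20] [[h01 h02] [h11 h21 h12 h22]]] i j ga al.
have mi e f (k : R * R * R * R -> R) : measurable_fun setT k ->
    measurable_fun setT (fun z => itvw e f (k z)).
  by move=> mk; apply: (measurableT_comp (measurable_itvw e f)).
have w3t := weight_setX weight_rect (weight_itv a b).
have w3v := weight_setX weight_rect (weight_itv c d).
have w4 := weight_setX w3t (weight_itv c d).
have m1 : measurable_fun setT (fun z : R * R * R * R => z.1.1) by mproj.
have mt : measurable_fun setT (fun z : R * R * R * R => itvw a b z.1.2).
  by apply: mi; mproj.
have mv : measurable_fun setT (fun z : R * R * R * R => itvw c d z.2).
  by apply: mi; mproj.
have m3t : measurable_fun setT (fun z : R * R * R * R => (z.1.1, z.1.2)).
  by apply: measurable_fun_pair; mproj.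
have m3v : measurable_fun setT (fun z : R * R * R * R => (z.1.1, z.2)).
  by apply: measurable_fun_pair; mproj.
have mid : measurable_fun setT (fun z : R * R * R * R => z) by mproj.
have mcst1 : measurable_fun setT (fun z : R * R * R * R => 1 : R) by exact: measurable_cst.
have E00 (z : R * R * R * R) : rectw a b c d (z.1.1.1, z.1.1.2) * rectw a b c d (z.1.2, z.2) =
  (itvw a b z.1.2 * itvw c d z.2) * rectw a b c d z.1.1.
  by rewrite mulrC; case: z => -[[x y] t] v.
have E3t (z : R * R * R * R) : rectw a b c d (z.1.1.1, z.1.1.2) * rectw a b c d (z.1.2, z.2) =
  itvw c d z.2 * (rectw a b c d z.1.1 * itvw a b z.1.2).
  by rewrite E00; ring.
have E3v (z : R * R * R * R) : rectw a b c d (z.1.1.1, z.1.1.2) * rectw a b c d (z.1.2, z.2) =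
  itvw a b z.1.2 * (rectw a b c d z.1.1 * itvw c d z.2).
  by rewrite E00; ring.
have E4 (z : R * R * R * R) : rectw a b c d (z.1.1.1, z.1.1.2) * rectw a b c d (z.1.2, z.2) =
  1 * ((rectw a b c d z.1.1 * itvw a b z.1.2) * itvw c d z.2).
  by rewrite E00; ring.
have mtv := measurable_funM mt mv.
have k00 : measurable_fun setT (fun z : R * R =>
    rectw a b c d z * pi_00 Z z.1 z.2 ga al).
  exact: (measurable_L2_weight (h00 ga al) weight_rect).
have k10 : measurable_fun setT (fun z : R * R * R =>
    rectw a b c d z.1 * itvw a b z.2 * pi_10 Z z.1.1 z.1.2 z.2 ga al).
  exact: (measurable_L2_weight (h10 ga al) w3t).
have k20 : measurable_fun setT (fun z : R * R * R =>
    rectw a b c d z.1 * itvw a b z.2 * pi_20 Z z.1.1 z.1.2 z.2 ga al).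
  exact: (measurable_L2_weight (h20 ga al) w3t).
have k01 : measurable_fun setT (fun z : R * R * R =>
    rectw a b c d z.1 * itvw c d z.2 * pi_01 Z z.1.1 z.1.2 z.2 ga al).
  exact: (measurable_L2_weight (h01 ga al) w3v).
have k02 : measurable_fun setT (fun z : R * R * R =>
    rectw a b c d z.1 * itvw c d z.2 * pi_02 Z z.1.1 z.1.2 z.2 ga al).
  exact: (measurable_L2_weight (h02 ga al) w3v).
have k11 : measurable_fun setT (fun z : R * R * R * R =>
    rectw a b c d z.1.1 * itvw a b z.1.2 * itvw c d z.2 * pi_11 Z z.1.1.1 z.1.1.2 z.1.2 z.2 ga al).
  exact: (measurable_L2_weight (h11 ga al) w4).
have k21 : measurable_fun setT (fun z : R * R * R * R =>
    rectw a b c d z.1.1 * itvw a b z.1.2 * itvw c d z.2 * pi_21 Z z.1.1.1 z.1.1.2 z.1.2 z.2 ga al).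
  exact: (measurable_L2_weight (h21 ga al) w4).
have k12 : measurable_fun setT (fun z : R * R * R * R =>
    rectw a b c d z.1.1 * itvw a b z.1.2 * itvw c d z.2 * pi_12 Z z.1.1.1 z.1.1.2 z.1.2 z.2 ga al).
  exact: (measurable_L2_weight (h12 ga al) w4).
have k22 : measurable_fun setT (fun z : R * R * R * R =>
    rectw a b c d z.1.1 * itvw a b z.1.2 * itvw c d z.2 * pi_22 Z z.1.1.1 z.1.1.2 z.1.2 z.2 ga al).
  exact: (measurable_L2_weight (h22 ga al) w4).
case: i => [|[|i]]; case: j => [|[|j]].
- exact: (measurable_weight4 (f := fun x y t v => pi_ker Z 0 0 x y t v ga al)
    k00 m1 mtv E00 (fun=> erefl)).
- exact: (measurable_weight4 (f := fun x y t v => pi_ker Z 0 1 x y t v ga al)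
    k01 m3v mt E3v (fun=> erefl)).
- exact: (measurable_weight4 (f := fun x y t v => pi_ker Z 0 j.+2 x y t v ga al)
    k02 m3v mt E3v (fun=> erefl)).
- exact: (measurable_weight4 (f := fun x y t v => pi_ker Z 1 0 x y t v ga al)
    k10 m3t mv E3t (fun=> erefl)).
- exact: (measurable_weight4 (f := fun x y t v => pi_ker Z 1 1 x y t v ga al)
    k11 mid mcst1 E4 (fun=> erefl)).
- exact: (measurable_weight4 (f := fun x y t v => pi_ker Z 1 j.+2 x y t v ga al)
    k12 mid mcst1 E4 (fun=> erefl)).
- exact: (measurable_weight4 (f := fun x y t v => pi_ker Z i.+2 0 x y t v ga al)
    k20 m3t mv E3t (fun=> erefl)).
- exact: (measurable_weight4 (f := fun x y t v => pi_ker Z i.+2 1 x y t v ga al)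
    k21 mid mcst1 E4 (fun=> erefl)).
- exact: (measurable_weight4 (f := fun x y t v => pi_ker Z i.+2 j.+2 x y t v ga al)
    k22 mid mcst1 E4 (fun=> erefl)).
Qed.

Variable g : R -> R -> R.

Definition cutv (u : R -> R -> 'cV[R]_n) (k : 'I_n) : R -> R -> R :=
  cutf (fun x y => u x y k 0).

Lemma sum_33 (f : nat -> nat -> R) :
  \sum_(k < 3) \sum_(r < 3) f k r =
  f 0 0 + f 1 0 + f 2 0 + f 0 1 + f 0 2 + f 1 1 + f 2 1 + f 1 2 + f 2 2.
Proof.
rewrite (sum3E (fun k => \sum_(r < 3) f k r)) !(sum3E (f _)); ring.
Qed.

Local Arguments gint : simpl never.
Local Arguments part_gfun : simpl never.

(** The substitution in the hypothesis on [N] and [M] is consistent with the layers: for index 0 the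
    layer is a delta at [x] or [y], which evaluates [M] at exactly the placeholder that [LPI]
    passes. *)
Lemma PI_op_gint (N : pi_array R n n)
    (M : nat -> nat -> R -> R -> R -> R -> 'M[R]_n) u x y k :
  (forall i j x y t v, (i < 3)%N -> (j < 3)%N -> pi_ker N i j x y t v =
    M i j x y (if i == 0%N then x else t) (if j == 0%N then y else v)) ->
  (x, y) \in rect ->
  PI_op a b c d N u x y k 0 =
  \sum_(i < 3) \sum_(j < 3) gint a b (part_gfun i x) (fun t =>
    gint c d (part_gfun j y) (fun v => (M i j x y t v *m u t v) k 0)).
Proof.
move=> NM; rewrite mem_rect => /andP[hx hy].
rewrite (sum_33 (fun i j => gint a b (part_gfun i x) (fun t =>
    gint c d (part_gfun j y) (fun v => (M i j x y t v *m u t v) k 0)))).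
rewrite mxE.
have N00 := NM 0%N 0%N x y; have N10 := NM 1%N 0%N x y; have N20 := NM 2%N 0%N x y.
have N01 := NM 0%N 1%N x y; have N02 := NM 0%N 2%N x y; have N11 := NM 1%N 1%N x y.
have N21 := NM 2%N 1%N x y; have N12 := NM 1%N 2%N x y; have N22 := NM 2%N 2%N x y.
rewrite /= in N00 N10 N20 N01 N02 N11 N21 N12 N22.
have add9 (x1 x2 x3 x4 x5 x6 x7 x8 x9 y1 y2 y3 y4 y5 y6 y7 y8 y9 : R) :
    x1 = y1 -> x2 = y2 -> x3 = y3 -> x4 = y4 -> x5 = y5 -> x6 = y6 -> x7 = y7 -> x8 = y8 -> x9 = y9 ->
    x1 + x2 + x3 + x4 + x5 + x6 + x7 + x8 + x9 = y1 + y2 + y3 + y4 + y5 + y6 + y7 + y8 + y9.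
  by do 9 move=> ->.
apply: add9.
- by rewrite (N00 x y).
- rewrite [RHS](gint_part1 _ hx); apply: eq_Rintegral => t _; rewrite (N10 t y)//.
- rewrite [RHS](gint_part2 _ hx); apply: eq_Rintegral => t _; rewrite (N20 t y)//.
- rewrite [RHS](gint_part1 _ hy); apply: eq_Rintegral => v _; rewrite (N01 x v)//.
- rewrite [RHS](gint_part2 _ hy); apply: eq_Rintegral => v _; rewrite (N02 x v)//.
- rewrite [RHS](gint_part1 _ hx); apply: eq_Rintegral => t _; rewrite [RHS](gint_part1 _ hy).
  by apply: eq_Rintegral => v _; rewrite N11.
- rewrite [RHS](gint_part2 _ hx); apply: eq_Rintegral => t _; rewrite [RHS](gint_part1 _ hy).
  by apply: eq_Rintegral => v _; rewrite N21.
- rewrite [RHS](gint_part1 _ hx); apply: eq_Rintegral => t _; rewrite [RHS](gint_part2 _ hy).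
  by apply: eq_Rintegral => v _; rewrite N12.
- rewrite [RHS](gint_part2 _ hx); apply: eq_Rintegral => t _; rewrite [RHS](gint_part2 _ hy).
  by apply: eq_Rintegral => v _; rewrite N22.
Qed.

(** At a point of the rectangle every layer stays in its interval, deltas included, so all the
    indicators that enter equal 1. *)
Lemma PI_op_opT P u x y k : (x, y) \in rect ->
  PI_op a b c d (LPI a b c d Z g P) u x y k 0 =
  opT a b c d P (cutf g) cutZ (cutv u) k x y.
Proof.
move=> xy; apply: (etrans (PI_op_gint (M := LPI_ker a b c d Z g P) u k _ xy)).
  by move=> [|[|[|i]]] [|[|[|j]]].
move: xy; rewrite mem_rect => /andP[hx hy].
apply: eq_bigr => i0 _; apply: eq_bigr => r _.
apply: eq_gint_in; [exact: part_in|move=> t ht].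
apply: eq_gint_in; [exact: part_in|move=> v hv].
rewrite mxE; apply: eq_bigr => be _.
rewrite /cutv /cutf rectw1// mul1r; congr (_ * _).
rewrite mxE; do 4 (apply: eq_bigr => ? _).
apply: eq_gint_in; [exact: Psi_in|move=> eta heta].
apply: eq_gint_in; [exact: Psi_in|move=> mu hmu].
rewrite rectw1// mul1r mxE; congr (_ * _).
apply: eq_bigr => de _; rewrite mxE /cutZ !rectw1// !mul1r; congr (_ * _).
by apply: eq_bigr => ga _; rewrite !mxE ?mul1r.
Qed.

End cut.

(** * Square integrability, symmetry and positivity of the operator *)

Lemma sym_form (R : realType) (m : nat) (P : 'M[R]_m) (w1 w2 : 'cV[R]_m) :
  P^T = P -> (w1^T *m P *m w2) 0 0 = (w2^T *m P *m w1) 0 0.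
Proof.
move=> PT; have <- : (w2^T *m P *m w1)^T = w1^T *m P *m w2.
  by rewrite !trmx_mul trmxK PT mulmxA.
by rewrite mxE.
Qed.

Section main.
Context {R : realType}.
Variables (a b c d : R) (q n : nat) (Z : pi_array R q n) (g : R -> R -> R).
Hypothesis hZ : N2D a b c d Z.
Hypothesis hg : L2_on (@leb2 R) (rect a b c d) (fun z => g z.1 z.2).
Hypothesis hg0 : forall x y : R, a <= x <= b -> c <= y <= d -> 0 <= g x y.
Hypothesis hwp : LPI_well_posed a b c d Z g.
Local Notation G := (cutf a b c d g).
Local Notation A := (cutZ a b c d Z).
Local Notation cutu := (@cutv R a b c d n).
Local Arguments egint : simpl never.

Let mG : measurable_fun setT (fun z : R * R => G z.1 z.2).
Proof. exact: measurable_cutf hg. Qed.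

Let mA : forall i j ga al, measurable_fun setT
  (fun z : R * R * R * R => A i j ga al z.1.1.1 z.1.1.2 z.1.2 z.2).
Proof. exact: measurable_cutZ. Qed.

Let G0 x y : 0 <= G x y.
Proof.
rewrite /cutf weight_rect mem_rect; case: ifP => [/andP[hx hy]|_].
  by rewrite mul1r hg0.
by rewrite mul0r.
Qed.

Lemma measurable_cutu u k : L2_rect a b c d u ->
  measurable_fun setT (fun z : R * R => cutu u k z.1 z.2).
Proof. by move=> Lu; apply: measurable_cutf; exact: Lu. Qed.

(** Well-posedness bounds the integral built from the sum over all entries of $Z_{ij}$, and a single
    entry is dominated by that sum. *)
Lemma finite_cutu u : L2_rect a b c d u -> finiteA a b c d G A (cutu u).
Proof.
move=> Lu i j ga al i3 j3.
have mu k := measurable_cutu k Lu.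
have gp1 := part_gpos (R := R).
pose S (x y t v : R) : R := \sum_(al < q) \sum_(be < n) `|A i j al be x y t v * cutu u be t v|.
have mS : measurable_fun setT (fun z : R * R * R * R => (S z.1.1.1 z.1.1.2 z.1.2 z.2)%:E).
  apply/measurable_EFinP; do 2 (apply: measurable_sum => ?).
  apply: measurableT_comp => //; apply: measurable_funM; first exact: mA.
  by apply: (measurable_comp2 (mu _)); mproj.
have S0 x y t v : 0 <= S x y t v by do 2 apply: sumr_ge0 => ? _.
(* [K] is the inner integral of the well-posedness condition, written with layers and cut data; the
   two agree on the rectangle. *)
pose K (eta mu : R) : \bar R := egint a b (part_gfun i eta) (fun t =>
  egint c d (part_gfun j mu) (fun v => (S eta mu t v)%:E)).
have K0 eta mu0 : (0 <= K eta mu0)%E.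
  by apply: egint_ge0 => // t; apply: egint_ge0 => // v; rewrite lee_fin.
have mK1 : measurable_fun setT (fun z : R * R * R =>
    egint c d (part_gfun j z.1.2) (fun v => (S z.1.1 z.1.2 z.2 v)%:E)).
  apply: measurable_egint; [by apply: mgfun_part_comp; mproj|exact: mS|].
  by move=> *; rewrite lee_fin.
have mK : measurable_fun setT (fun z : R * R => K z.1 z.2).
  apply: measurable_egint; [by apply: mgfun_part_comp; mproj|exact: mK1|].
  by move=> *; apply: egint_ge0 => // ?; rewrite lee_fin.
have N0 eta mu0 : (0 <= normA a b c d A (cutu u) i j ga al eta mu0)%E by exact: normA_ge0.
have mN : measurable_fun setT (fun z : R * R => normA a b c d A (cutu u) i j ga al z.1 z.2).
  exact: measurable_normA.
have mEG : measurable_fun setT (fun z : R * R => (G z.1 z.2)%:E) by exact/measurable_EFinP.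
have sqr0 (x : \bar R) : (0 <= x -> 0 <= x ^+ 2)%E by move=> x0; rewrite expe2 mule_ge0.
have NK eta mu0 : (normA a b c d A (cutu u) i j ga al eta mu0 <= K eta mu0)%E.
  have mAU := measurable_AU mA i j ga (mu al).
  apply: le_egint => //.
  - apply: measurable_egint; [by apply: mgfun_part_comp; mproj| |by move=> *; rewrite lee_fin].
    by apply: (measurable_comp4 (F := fun x y t v => `|A i j ga al x y t v * cutu u al t v|%:E) mAU); mproj.
  - by apply: (measurable_comp3 (F := fun x y t => egint c d (part_gfun j y) (fun v => (S x y t v)%:E)) mK1); mproj.
  - by move=> t; apply: egint_ge0 => // v; rewrite lee_fin.
  move=> t; apply: le_egint => //.
  - by apply: (measurable_comp4 (F := fun x y t v => `|A i j ga al x y t v * cutu u al t v|%:E) mAU); mproj.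
  - by apply: (measurable_comp4 (F := fun x y t v => (S x y t v)%:E) mS); mproj.
  move=> v; rewrite lee_fin /S (bigD1 ga)//= (bigD1 al)//= -addrA lerDl.
  by apply: addr_ge0; apply: sumr_ge0 => ? _ //; apply: sumr_ge0.
have GK0 eta mu0 : (0 <= (G eta mu0)%:E * K eta mu0 ^+ 2)%E.
  by rewrite mule_ge0 ?lee_fin ?G0 ?sqr0.
have GN0 eta mu0 : (0 <= (G eta mu0)%:E * normA a b c d A (cutu u) i j ga al eta mu0 ^+ 2)%E.
  by rewrite mule_ge0 ?lee_fin ?G0 ?sqr0.
have mGK : measurable_fun setT (fun z : R * R => ((G z.1 z.2)%:E * K z.1 z.2 ^+ 2)%E).
  by apply: emeasurable_funM => //; exact: (emeasurable_funM mK mK).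
have mGN : measurable_fun setT (fun z : R * R =>
    ((G z.1 z.2)%:E * normA a b c d A (cutu u) i j ga al z.1 z.2 ^+ 2)%E).
  by apply: emeasurable_funM => //; exact: (emeasurable_funM mN mN).
have := hwp (Ordinal i3) (Ordinal j3) Lu; apply: le_lt_trans.
apply: (@le_trans _ _ (egint a b gunit (fun eta => egint c d gunit (fun mu0 =>
  ((G eta mu0)%:E * K eta mu0 ^+ 2)%E)))).
  apply: le_egint; [exact: unit_gpos| | | |move=> eta].
  - by apply: measurable_egint; [exact: mgfun_unit|exact: mGN|exact: GN0].
  - by apply: measurable_egint; [exact: mgfun_unit|exact: mGK|exact: GK0].
  - by move=> eta; apply: egint_ge0; [exact: unit_gpos|exact: GN0].
  apply: le_egint; [exact: unit_gpos| | |exact: GN0|move=> mu0].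
  - by apply: (measurable_comp2 (F := fun x y => ((G x y)%:E * normA a b c d A (cutu u) i j ga al x y ^+ 2)%E) mGN); mproj.
  - by apply: (measurable_comp2 (F := fun x y => ((G x y)%:E * K x y ^+ 2)%E) mGK); mproj.
  apply: lee_wpmul2l; first by rewrite lee_fin G0.
  by rewrite !expe2; apply: lee_pmul.
rewrite -integral_rect; [|exact: mGK|exact: GK0].
rewrite le_eqVlt; apply/orP; left; apply/eqP; apply: eq_integral => -[x y].
rewrite mem_rect => /andP[hx hy]; rewrite /= /cutf rectw1// mul1r.
congr (_ * _ ^+ 2)%E; rewrite /K -egint_part//.
apply: eq_egint_in; [exact: part_in|move=> t ht].
rewrite -egint_part//; apply: eq_egint_in; [exact: part_in|move=> v hv].
congr (_%:E); apply: eq_bigr => k _; apply: eq_bigr => l _.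
by rewrite /cutZ /cutv /cutf !rectw1// !mul1r normrM.
Qed.

Lemma measure_rect_lty : (@leb2 R (rect a b c d) < +oo)%E.
Proof.
have -> : @leb2 R (rect a b c d) =
    (@lebesgue_measure R `[a, b]%classic * @lebesgue_measure R `[c, d]%classic)%E.
  by apply: product_measure1E; exact: measurable_itv.
have fin (al be : R) : exists2 r : R, 0 <= r & @lebesgue_measure R `[al, be]%classic = r%:E.
  rewrite lebesgue_measure_itv /= lte_fin; case: ifP => [albe|_]; last by exists 0.
  by exists (be - al); rewrite ?EFinB// subr_ge0 ltW.
have [r1 r10 ->] := fin a b; have [r2 r20 ->] := fin c d.
by rewrite -EFinM ltry.
Qed.

Variable P : 'M[R]_(9 * q).
Local Notation T := (PI_op a b c d (LPI a b c d Z g P)).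

Lemma patch_PI_op u k : ((fun z => T u z.1 z.2 k 0) \_ (rect a b c d)) =
  (fun z => rectw a b c d z * opT a b c d P G A (cutu u) k z.1 z.2).
Proof.
apply/funext => -[x y]; rewrite patchE weight_rect; case: ifPn => xy.
  by rewrite mul1r /= (PI_op_opT Z g P u k xy).
by rewrite mul0r.
Qed.

(** Supplies the test vectors of the resonance argument, one component at a time. *)
Lemma L2_single k (w : R * R -> R) : measurable_fun setT w ->
  (\int[@leb2 R]_z (w z ^+ 2)%:E < +oo)%E ->
  L2_rect a b c d (fun x y => \col_(l < n) (if l == k then w (x, y) else 0)).
Proof.
move=> mw wfin l j; apply/L2_onP.
have E : ((fun z => (\col_(l0 < n) (if l0 == k then w (z.1, z.2) else 0)) l j) \_ (rect a b c d)) =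
    (fun z => rectw a b c d z * (if l == k then w z else 0)).
  rewrite (patch_weight _ (weight_rect a b c d)); apply/funext => -[x y].
  by rewrite mxE.
rewrite E; have mE : measurable_fun setT
    (fun z => rectw a b c d z * (if l == k then w z else 0)).
  apply: measurable_funM; first exact: measurable_rectw.
  by case: (l == k) => //; exact: measurable_cst.
split; first exact: mE.
apply: le_lt_trans wfin; apply: ge0_le_integral.
- exact: measurableT.
- by move=> z _; rewrite lee_fin sqr_ge0.
- by apply/measurable_EFinP; apply: measurable_funX; exact: mE.
- by apply/measurable_EFinP; apply: measurable_funX; exact: mw.
- move=> z _; rewrite lee_fin exprMn weight_rect.
  case: ifP => _; last by rewrite expr0n /= mul0r sqr_ge0.
  by rewrite expr1n mul1r; case: ifP => _ //; rewrite expr0n /= sqr_ge0.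
Qed.

Lemma L2_PI_op u : L2_rect a b c d u -> L2_rect a b c d (T u).
Proof.
move=> Lu k j; rewrite (ord1 j); apply/L2_onP; rewrite patch_PI_op.
have mu l := measurable_cutu l Lu.
have mT := measurable_opT a b c d P mG mA mu k.
have mrT : measurable_fun setT
    (fun z => rectw a b c d z * opT a b c d P G A (cutu u) k z.1 z.2).
  by apply: measurable_funM; [exact: measurable_rectw|exact: mT].
split; first exact: mrT.
pose h (z : R * R) := `|rectw a b c d z * opT a b c d P G A (cutu u) k z.1 z.2|.
have : (\int[@leb2 R]_z (h z ^+ 2)%:E < +oo)%E.
  apply: (@L2_resonance _ _ R (@leb2 R) (rect a b c d)).
  - exact: measurable_rect.
  - exact: measure_rect_lty.
  - by apply: measurableT_comp => //; exact: mrT.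
  - by move=> z; exact: normr_ge0.
  - move=> z /= zr; rewrite /h weight_rect memNset// mul0r normr0//.
  move=> w mw w0 wfin.
  (* Testing against $w e_k$ leaves the single term $w\,(\mathcal P[N]u)_k$, whose absolute integral
     is finite by absolute convergence of the form. *)
  have Lv := L2_single k mw wfin.
  have mv l := measurable_cutu l Lv.
  have := integral_abs_opT_lty P mG G0 mA mu mv (finite_cutu Lu) (finite_cutu Lv).
  apply: le_lt_trans; rewrite le_eqVlt; apply/orP; left; apply/eqP.
  rewrite [RHS]integral_mkcond epatch_rectw; apply: eq_integral => -[x y] _.
  rewrite (bigD1 k)//= big1 ?addr0; last first.
    by move=> l /negbTE lk; rewrite /cutv /cutf mxE lk mulr0 mul0r.
  rewrite /h /=; move: (opT a b c d P G A (cutu u) k x y) => O.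
  rewrite /cutv /cutf mxE eqxx weight_rect; case: ifP => _; last first.
    by rewrite !mul0r normr0 mul0r mul0e.
  by rewrite !mul1r mul1e normrM (ger0_norm (w0 _)) mulrC.
apply: le_lt_trans; rewrite le_eqVlt; apply/orP; left; apply/eqP.
by apply: eq_integral => z _; rewrite /h real_normK// num_real.
Qed.

Definition bil (u v : R -> R -> 'cV[R]_n) : R :=
  \int[@leb2 R]_(z in rect a b c d) (G z.1 z.2 *
    ((vecA a b c d A (cutu v) z.1 z.2)^T *m P *m vecA a b c d A (cutu u) z.1 z.2) 0 0).

Lemma inner_PI_opl u v : L2_rect a b c d u -> L2_rect a b c d v ->
  inner a b c d (T u) v = bil u v.
Proof.
move=> Lu Lv; have mu l := measurable_cutu l Lu; have mv l := measurable_cutu l Lv.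
apply: etrans (integral_opT P mG G0 mA mu mv (finite_cutu Lu) (finite_cutu Lv)).
apply: eq_Rintegral => -[x y] xy; apply: eq_bigr => k _.
rewrite (PI_op_opT Z g P u k xy) /= mulrC; congr (_ * _).
by rewrite /cutv /cutf weight_rect xy mul1r.
Qed.

Lemma innerC (u v : R -> R -> 'cV[R]_n) : inner a b c d u v = inner a b c d v u.
Proof.
by apply: eq_Rintegral => z _; apply: eq_bigr => k _; rewrite mulrC.
Qed.

Lemma bilC u v : P^T = P -> bil u v = bil v u.
Proof.
move=> PT; rewrite /bil; apply: eq_Rintegral => z _.
apply: (congr1 ( *%R _)); exact: sym_form.
Qed.

Lemma bil_ge0 u : psd P -> 0 <= bil u u.
Proof.
move=> [_ Ppos]; apply: Rintegral_ge0 => z _; apply: mulr_ge0; first exact: G0.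
exact: Ppos.
Qed.

End main.

Theorem proposition17 (R : realType) (a b c d : R) (hab : a < b) (hcd : c < d)
  (q n : nat) (Z : pi_array R q n) (hZ : N2D a b c d Z)
  (g : R -> R -> R)
  (hg : L2_on (@leb2 R) (rect a b c d) (fun z => g z.1 z.2))
  (hg0 : forall x y : R, a <= x <= b -> c <= y <= d -> 0 <= g x y)
  (hwp : LPI_well_posed a b c d Z g)
  (P : 'M[R]_(9 * q)) (hP : psd P)
  (N : pi_array R n n) (hN : N = LPI a b c d Z g P) :
  is_adjoint a b c d (PI_op a b c d N) (PI_op a b c d N) /\
  (forall u : R -> R -> 'cV[R]_n, L2_rect a b c d u ->
     0 <= inner a b c d u (PI_op a b c d N u)).
Proof.
have LT u : L2_rect a b c d u -> L2_rect a b c d (PI_op a b c d (LPI a b c d Z g P) u).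
  exact: L2_PI_op.
have bilE u v : L2_rect a b c d u -> L2_rect a b c d v ->
    inner a b c d (PI_op a b c d (LPI a b c d Z g P) u) v = bil a b c d Z g P u v.
  exact: inner_PI_opl.
rewrite hN; split; last by move=> u Lu; rewrite innerC bilE//; exact: bil_ge0.
split; [exact: LT|exact: LT|move=> u v Lu Lv].
(* With $B$ for [bil] and $T$ for the operator, $\langle Tu,v\rangle=B(u,v)=B(v,u)=\langle
   Tv,u\rangle$; the middle equality is the symmetry of [P]. *)
apply: (etrans (bilE u v Lu Lv)); apply: (etrans (bilC _ _ _ _ _ _ _ _ hP.1)).
apply: (etrans (esym (bilE v u Lv Lu))); exact: innerC.
Qed.
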